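(* For any $K$-variety $X$, there is a natural closed embedding (over $X$) of $TX$ into the prolongation cone $CX$.
   Context: $(K,\delta)$ is an algebraically closed differential field (a field with a derivation $\delta:K\to K$) containing an element $e$ with $\delta(e)=1$. A variety is an integral, separated $K$-scheme of finite type. $TX$ denotes $\mathbf{Spec}\,\mathrm{Sym}(\Omega_{X/K})$, which equals the usual tangent variety when $X$ is smooth. For a $K$-algebra $R$, the module of $\tau$-differentials $\Omega^\tau_R$ is the $R$-module generated by symbols $\tau r$, $r\in R$, with relations $\tau(r+s)=\tau r+\tau s$, $\tau(rs)=r\,\tau s+s\,\tau r$ for $r,s\in R$, and $\delta(a)\tau b=\delta(b)\tau a$ for $a,b\in K$. $\Omega^\tau_X$ is the quasi-coherent sheaf on $X$ whose sections on an open affine $\mathrm{Spec}\,R$ are $\Omega^\tau_R$. The prolongation cone of $X$ is $CX=\mathbf{Spec}\,\mathrm{Sym}(\Omega^\tau_X)$. *)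

(* Defs.v *)
From HB Require Import structures.
From mathcomp Require Import all_boot all_order all_algebra.
From mathcomp Require Import generic_quotient.
From mathcomp Require Import all_classical topology.

Set Implicit Arguments.
Unset Strict Implicit.
Unset Printing Implicit Defensive.

Import GRing.Theory.
Local Open Scope quotient_scope.
Local Open Scope ring_scope.
Local Open Scope classical_set_scope.

(* Rings are [comPzRingType]: the zero ring is needed, as the ring of sections
   over the empty set. *)

Inductive mterm (R : comPzRingType) (G : Type) : Type :=
| MZero
| MAdd of mterm R G & mterm R G
| MOpp of mterm R G
| MScale of R & mterm R G
| MGen of G.
Arguments MZero {R G}.
Arguments MGen {R G}.

HB.instance Definition _ (R : comPzRingType) (G : Type) :=
  gen_eqMixin (mterm R G).
HB.instance Definition _ (R : comPzRingType) (G : Type) :=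
  gen_choiceMixin (mterm R G).

Section PresentedModule.
Variables (R : comPzRingType) (G : Type).
Variable rel : mterm R G -> mterm R G -> Prop.

(* The least congruence containing [rel] modulo which the module axioms hold. *)
Inductive mcong : mterm R G -> mterm R G -> Prop :=
| mc_rel x y : rel x y -> mcong x y
| mc_refl x : mcong x x
| mc_sym x y : mcong x y -> mcong y x
| mc_trans y x z : mcong x y -> mcong y z -> mcong x z
| mc_add x x' y y' : mcong x x' -> mcong y y' -> mcong (MAdd x y) (MAdd x' y')
| mc_opp x x' : mcong x x' -> mcong (MOpp x) (MOpp x')
| mc_scale r x x' : mcong x x' -> mcong (MScale r x) (MScale r x')
| mc_addA x y z : mcong (MAdd x (MAdd y z)) (MAdd (MAdd x y) z)
| mc_addC x y : mcong (MAdd x y) (MAdd y x)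
| mc_add0 x : mcong (MAdd MZero x) x
| mc_addN x : mcong (MAdd (MOpp x) x) MZero
| mc_scaleA r s x : mcong (MScale r (MScale s x)) (MScale (r * s) x)
| mc_scale1 x : mcong (MScale 1 x) x
| mc_scaleDr r x y : mcong (MScale r (MAdd x y)) (MAdd (MScale r x) (MScale r y))
| mc_scaleDl r s x : mcong (MScale (r + s) x) (MAdd (MScale r x) (MScale s x)).

Definition mcongb x y : bool := `[< mcong x y >].

Lemma mcongb_refl : reflexive mcongb.
Proof. by move=> x; apply/asboolP; apply: mc_refl. Qed.

Lemma mcongb_sym : symmetric mcongb.
Proof. by move=> x y; apply/asboolP/asboolP; apply: mc_sym. Qed.

Lemma mcongb_trans : transitive mcongb.
Proof.
by move=> y x z /asboolP xy /asboolP yz; apply/asboolP; apply: mc_trans yz.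
Qed.

Canonical mcong_equiv := EquivRel mcongb mcongb_refl mcongb_sym mcongb_trans.

Definition pmod : Type := {eq_quot mcongb}.
HB.instance Definition _ := Choice.on pmod.
HB.instance Definition _ : EqQuotient _ mcongb pmod := EqQuotient.on pmod.

Lemma pmodP (x y : mterm R G) : \pi_pmod x = \pi_pmod y <-> mcong x y.
Proof.
split; first by move/eqmodP/asboolP.
by move=> h; apply/eqmodP/asboolP.
Qed.

Lemma pmod_reprK (x : mterm R G) : mcong (repr (\pi_pmod x)) x.
Proof. by apply/pmodP; rewrite reprK. Qed.

Definition pmod_gen (g : G) : pmod := \pi_pmod (MGen g).
Definition pmod_zero : pmod := \pi_pmod MZero.
Definition pmod_add (x y : pmod) : pmod := \pi_pmod (MAdd (repr x) (repr y)).
Definition pmod_opp (x : pmod) : pmod := \pi_pmod (MOpp (repr x)).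
Definition pmod_scale (r : R) (x : pmod) : pmod := \pi_pmod (MScale r (repr x)).

Lemma pmod_addE x y : pmod_add (\pi_pmod x) (\pi_pmod y) = \pi_pmod (MAdd x y).
Proof. by apply/pmodP; apply: mc_add; apply: pmod_reprK. Qed.

Lemma pmod_oppE x : pmod_opp (\pi_pmod x) = \pi_pmod (MOpp x).
Proof. by apply/pmodP; apply: mc_opp; apply: pmod_reprK. Qed.

Lemma pmod_scaleE r x : pmod_scale r (\pi_pmod x) = \pi_pmod (MScale r x).
Proof. by apply/pmodP; apply: mc_scale; apply: pmod_reprK. Qed.

Lemma pmod_addA : associative pmod_add.
Proof.
elim/quotW=> x; elim/quotW=> y; elim/quotW=> z.
rewrite (pmod_addE y z) (pmod_addE x y) !pmod_addE.
by apply/pmodP; apply: mc_addA.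
Qed.

Lemma pmod_addC : commutative pmod_add.
Proof.
elim/quotW=> x; elim/quotW=> y.
by rewrite !pmod_addE; apply/pmodP; apply: mc_addC.
Qed.

Lemma pmod_add0 : left_id pmod_zero pmod_add.
Proof. by elim/quotW=> x; rewrite pmod_addE; apply/pmodP; apply: mc_add0. Qed.

Lemma pmod_addN : left_inverse pmod_zero pmod_opp pmod_add.
Proof.
by elim/quotW=> x; rewrite (pmod_oppE x) pmod_addE; apply/pmodP; apply: mc_addN.
Qed.

HB.instance Definition _ :=
  GRing.isZmodule.Build pmod pmod_addA pmod_addC pmod_add0 pmod_addN.

Lemma pmod_scaleA r s x : pmod_scale r (pmod_scale s x) = pmod_scale (r * s) x.
Proof.
by elim/quotW: x => x; rewrite (pmod_scaleE s x) !pmod_scaleE; apply/pmodP;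
apply: mc_scaleA.
Qed.

Lemma pmod_scale1 : left_id 1 pmod_scale.
Proof. by elim/quotW=> x; rewrite pmod_scaleE; apply/pmodP; apply: mc_scale1. Qed.

Lemma pmod_scaleDr : right_distributive pmod_scale +%R.
Proof.
move=> r; elim/quotW=> x; elim/quotW=> y.
rewrite /GRing.add /= (pmod_addE x y) (pmod_scaleE r x) (pmod_scaleE r y).
rewrite pmod_addE pmod_scaleE.
by apply/pmodP; apply: mc_scaleDr.
Qed.

Lemma pmod_scaleDl x : {morph pmod_scale^~ x : r s / r + s}.
Proof.
move=> r s; elim/quotW: x => x.
rewrite [in RHS]/GRing.add /= (pmod_scaleE r x) (pmod_scaleE s x).
rewrite pmod_addE pmod_scaleE; by apply/pmodP; apply: mc_scaleDl.
Qed.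

HB.instance Definition _ := GRing.Zmodule_isLmodule.Build R pmod
  pmod_scaleA pmod_scale1 pmod_scaleDr pmod_scaleDl.

End PresentedModule.

Section LiftModule.
Variables (R S : comPzRingType) (phi : {rmorphism R -> S}).
Variables (G : Type) (rel : mterm R G -> mterm R G -> Prop).
Variables (N : lmodType S) (u : G -> N).

Fixpoint meval (x : mterm R G) : N :=
  match x with
  | MZero => 0
  | MAdd x y => meval x + meval y
  | MOpp x => - meval x
  | MScale r x => phi r *: meval x
  | MGen g => u g
  end.

Definition pmod_lift (x : pmod rel) : N := meval (repr x).

Hypothesis urel : forall x y, rel x y -> meval x = meval y.

Lemma meval_cong x y : mcong rel x y -> meval x = meval y.
Proof.
elim=> //=.
- by move=> x' y' z' _ -> _ ->.
- by move=> x1 x2 y1 y2 _ -> _ ->.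
- by move=> x1 x2 _ ->.
- by move=> r x1 x2 _ ->.
- by move=> *; rewrite addrA.
- by move=> *; rewrite addrC.
- by move=> *; rewrite add0r.
- by move=> *; rewrite addNr.
- by move=> *; rewrite scalerA rmorphM.
- by move=> *; rewrite rmorph1 scale1r.
- by move=> *; rewrite scalerDr.
- by move=> *; rewrite rmorphD scalerDl.
Qed.

Lemma pmod_liftE x : pmod_lift (\pi_(pmod rel) x) = meval x.
Proof. by apply: meval_cong; apply: pmod_reprK. Qed.

Lemma pmod_lift_gen g : pmod_lift (pmod_gen rel g) = u g.
Proof. by rewrite pmod_liftE. Qed.

Lemma pmod_liftD : {morph pmod_lift : x y / x + y}.
Proof.
elim/quotW=> x; elim/quotW=> y.
by rewrite [in LHS]/GRing.add /= pmod_addE !pmod_liftE.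
Qed.

Lemma pmod_liftZ r x : pmod_lift (r *: x) = phi r *: pmod_lift x.
Proof.
elim/quotW: x => x.
by rewrite [in LHS]/GRing.scale /= pmod_scaleE !pmod_liftE.
Qed.

End LiftModule.

(* [Sym M] is the commutative R-algebra generated by the elements of M, subject
   to the relations making M -> Sym M an R-linear map. *)

Inductive sterm (R : comPzRingType) (M : Type) : Type :=
| SConst of R
| SGen of M
| SAdd of sterm R M & sterm R M
| SOpp of sterm R M
| SMul of sterm R M & sterm R M.
Arguments SConst {R M}.
Arguments SGen {R M}.

HB.instance Definition _ (R : comPzRingType) (M : Type) :=
  gen_eqMixin (sterm R M).
HB.instance Definition _ (R : comPzRingType) (M : Type) :=
  gen_choiceMixin (sterm R M).

Section SymmetricAlgebra.
Variables (R : comPzRingType) (M : lmodType R).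

Inductive scong : sterm R M -> sterm R M -> Prop :=
| sc_refl x : scong x x
| sc_sym x y : scong x y -> scong y x
| sc_trans y x z : scong x y -> scong y z -> scong x z
| sc_add x x' y y' : scong x x' -> scong y y' -> scong (SAdd x y) (SAdd x' y')
| sc_opp x x' : scong x x' -> scong (SOpp x) (SOpp x')
| sc_mul x x' y y' : scong x x' -> scong y y' -> scong (SMul x y) (SMul x' y')
| sc_addA x y z : scong (SAdd x (SAdd y z)) (SAdd (SAdd x y) z)
| sc_addC x y : scong (SAdd x y) (SAdd y x)
| sc_add0 x : scong (SAdd (SConst 0) x) x
| sc_addN x : scong (SAdd (SOpp x) x) (SConst 0)
| sc_mulA x y z : scong (SMul x (SMul y z)) (SMul (SMul x y) z)
| sc_mulC x y : scong (SMul x y) (SMul y x)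
| sc_mul1 x : scong (SMul (SConst 1) x) x
| sc_mulDl x y z : scong (SMul (SAdd x y) z) (SAdd (SMul x z) (SMul y z))
| sc_constD r s : scong (SConst (r + s)) (SAdd (SConst r) (SConst s))
| sc_constM r s : scong (SConst (r * s)) (SMul (SConst r) (SConst s))
| sc_genD m n : scong (SGen (m + n)) (SAdd (SGen m) (SGen n))
| sc_genZ r m : scong (SGen (r *: m)) (SMul (SConst r) (SGen m)).

Definition scongb x y : bool := `[< scong x y >].

Lemma scongb_refl : reflexive scongb.
Proof. by move=> x; apply/asboolP; apply: sc_refl. Qed.

Lemma scongb_sym : symmetric scongb.
Proof. by move=> x y; apply/asboolP/asboolP; apply: sc_sym. Qed.

Lemma scongb_trans : transitive scongb.
Proof.
by move=> y x z /asboolP xy /asboolP yz; apply/asboolP; apply: sc_trans yz.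
Qed.

Canonical scong_equiv := EquivRel scongb scongb_refl scongb_sym scongb_trans.

Definition Sym : Type := {eq_quot scongb}.
HB.instance Definition _ := Choice.on Sym.
HB.instance Definition _ : EqQuotient _ scongb Sym := EqQuotient.on Sym.

Lemma SymP (x y : sterm R M) : \pi_Sym x = \pi_Sym y <-> scong x y.
Proof.
split; first by move/eqmodP/asboolP.
by move=> h; apply/eqmodP/asboolP.
Qed.

Lemma Sym_reprK (x : sterm R M) : scong (repr (\pi_Sym x)) x.
Proof. by apply/SymP; rewrite reprK. Qed.

Definition Sym_const (r : R) : Sym := \pi_Sym (SConst r).
Definition Sym_gen (m : M) : Sym := \pi_Sym (SGen m).
Definition Sym_add (x y : Sym) : Sym := \pi_Sym (SAdd (repr x) (repr y)).
Definition Sym_opp (x : Sym) : Sym := \pi_Sym (SOpp (repr x)).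
Definition Sym_mul (x y : Sym) : Sym := \pi_Sym (SMul (repr x) (repr y)).

Lemma Sym_addE x y : Sym_add (\pi_Sym x) (\pi_Sym y) = \pi_Sym (SAdd x y).
Proof. by apply/SymP; apply: sc_add; apply: Sym_reprK. Qed.

Lemma Sym_oppE x : Sym_opp (\pi_Sym x) = \pi_Sym (SOpp x).
Proof. by apply/SymP; apply: sc_opp; apply: Sym_reprK. Qed.

Lemma Sym_mulE x y : Sym_mul (\pi_Sym x) (\pi_Sym y) = \pi_Sym (SMul x y).
Proof. by apply/SymP; apply: sc_mul; apply: Sym_reprK. Qed.

Lemma Sym_addA : associative Sym_add.
Proof.
elim/quotW=> x; elim/quotW=> y; elim/quotW=> z.
rewrite (Sym_addE y z) (Sym_addE x y) !Sym_addE.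
by apply/SymP; apply: sc_addA.
Qed.

Lemma Sym_addC : commutative Sym_add.
Proof.
elim/quotW=> x; elim/quotW=> y.
by rewrite !Sym_addE; apply/SymP; apply: sc_addC.
Qed.

Lemma Sym_add0 : left_id (Sym_const 0) Sym_add.
Proof. by elim/quotW=> x; rewrite Sym_addE; apply/SymP; apply: sc_add0. Qed.

Lemma Sym_addN : left_inverse (Sym_const 0) Sym_opp Sym_add.
Proof.
by elim/quotW=> x; rewrite (Sym_oppE x) Sym_addE; apply/SymP; apply: sc_addN.
Qed.

HB.instance Definition _ :=
  GRing.isZmodule.Build Sym Sym_addA Sym_addC Sym_add0 Sym_addN.

Lemma Sym_mulA : associative Sym_mul.
Proof.
elim/quotW=> x; elim/quotW=> y; elim/quotW=> z.
rewrite (Sym_mulE y z) (Sym_mulE x y) !Sym_mulE.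
by apply/SymP; apply: sc_mulA.
Qed.

Lemma Sym_mulC : commutative Sym_mul.
Proof.
elim/quotW=> x; elim/quotW=> y.
by rewrite !Sym_mulE; apply/SymP; apply: sc_mulC.
Qed.

Lemma Sym_mul1 : left_id (Sym_const 1) Sym_mul.
Proof. by elim/quotW=> x; rewrite Sym_mulE; apply/SymP; apply: sc_mul1. Qed.

Lemma Sym_mulDl : left_distributive Sym_mul +%R.
Proof.
elim/quotW=> x; elim/quotW=> y; elim/quotW=> z.
rewrite /GRing.add /= (Sym_addE x y) (Sym_mulE x z) (Sym_mulE y z).
rewrite Sym_mulE Sym_addE.
by apply/SymP; apply: sc_mulDl.
Qed.

HB.instance Definition _ := GRing.Zmodule_isComPzRing.Build Sym
  Sym_mulA Sym_mulC Sym_mul1 Sym_mulDl.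

Lemma Sym_constD : {morph Sym_const : r s / r + s}.
Proof.
by move=> r s; rewrite [in RHS]/GRing.add /= Sym_addE; apply/SymP/sc_constD.
Qed.

Lemma Sym_constM : {morph Sym_const : r s / r * s}.
Proof.
by move=> r s; rewrite [in RHS]/GRing.mul /= Sym_mulE; apply/SymP/sc_constM.
Qed.

HB.instance Definition _ := GRing.isNmodMorphism.Build R Sym Sym_const
  (conj erefl Sym_constD).
HB.instance Definition _ := GRing.isMonoidMorphism.Build R Sym Sym_const
  (conj erefl Sym_constM).

Lemma Sym_genD : {morph Sym_gen : m n / m + n}.
Proof.
by move=> m n; rewrite [in RHS]/GRing.add /= Sym_addE; apply/SymP/sc_genD.
Qed.

Lemma Sym_genZ r m : Sym_gen (r *: m) = Sym_const r * Sym_gen m.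
Proof. by rewrite [in RHS]/GRing.mul /= Sym_mulE; apply/SymP/sc_genZ. Qed.

End SymmetricAlgebra.

Section LiftSym.
Variables (R B : comPzRingType) (phi : {rmorphism R -> B}).
Variables (M : lmodType R) (u : M -> B).
Hypothesis uD : {morph u : m n / m + n}.
Hypothesis uZ : forall r m, u (r *: m) = phi r * u m.

Fixpoint seval (x : sterm R M) : B :=
  match x with
  | SConst r => phi r
  | SGen m => u m
  | SAdd x y => seval x + seval y
  | SOpp x => - seval x
  | SMul x y => seval x * seval y
  end.

Lemma seval_cong x y : scong x y -> seval x = seval y.
Proof.
elim=> //=.
- by move=> x' y' z' _ -> _ ->.
- by move=> x1 x2 y1 y2 _ -> _ ->.
- by move=> x1 x2 _ ->.
- by move=> x1 x2 y1 y2 _ -> _ ->.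
- by move=> *; rewrite addrA.
- by move=> *; rewrite addrC.
- by move=> *; rewrite rmorph0 add0r.
- by move=> *; rewrite addNr rmorph0.
- by move=> *; rewrite mulrA.
- by move=> *; rewrite mulrC.
- by move=> *; rewrite rmorph1 mul1r.
- by move=> *; rewrite mulrDl.
- by move=> *; rewrite rmorphD.
- by move=> *; rewrite rmorphM.
Qed.

Definition Sym_lift_fun (x : Sym M) : B := seval (repr x).

Lemma Sym_liftE x : Sym_lift_fun (\pi_(Sym M) x) = seval x.
Proof. by apply: seval_cong; apply: Sym_reprK. Qed.

Lemma Sym_lift_is_nmod_morphism : nmod_morphism Sym_lift_fun.
Proof.
split; first by rewrite Sym_liftE /= rmorph0.
elim/quotW=> x; elim/quotW=> y.
by rewrite [in LHS]/GRing.add /= Sym_addE !Sym_liftE.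
Qed.

Lemma Sym_lift_is_monoid_morphism : monoid_morphism Sym_lift_fun.
Proof.
split; first by rewrite Sym_liftE /= rmorph1.
elim/quotW=> x; elim/quotW=> y.
by rewrite [in LHS]/GRing.mul /= Sym_mulE !Sym_liftE.
Qed.

Definition Sym_lift : {rmorphism Sym M -> B} :=
  HB.pack Sym_lift_fun
    (GRing.isNmodMorphism.Build _ _ _ Sym_lift_is_nmod_morphism)
    (GRing.isMonoidMorphism.Build _ _ _ Sym_lift_is_monoid_morphism).

Lemma Sym_lift_const r : Sym_lift (Sym_const M r) = phi r.
Proof. exact: Sym_liftE. Qed.

Lemma Sym_lift_gen m : Sym_lift (Sym_gen m) = u m.
Proof. exact: Sym_liftE. Qed.

End LiftSym.

Section SymMap.
Variables (R S : comPzRingType) (phi : {rmorphism R -> S}).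
Variables (M : lmodType R) (N : lmodType S) (f : M -> N).
Hypothesis fD : {morph f : m n / m + n}.
Hypothesis fZ : forall r m, f (r *: m) = phi r *: f m.

Lemma Sym_map_add : {morph (@Sym_gen S N \o f) : m n / m + n}.
Proof. by move=> m n /=; rewrite fD Sym_genD. Qed.

Lemma Sym_map_scale r m :
  (@Sym_gen S N \o f) (r *: m)
  = (@Sym_const S N \o phi) r * (@Sym_gen S N \o f) m.
Proof. by rewrite /= fZ Sym_genZ. Qed.

Definition Sym_map : {rmorphism Sym M -> Sym N} :=
  @Sym_lift _ _ (@Sym_const S N \o phi) _ _ Sym_map_add Sym_map_scale.

End SymMap.

Definition derivation (K : comPzRingType) (delta : K -> K) : Prop :=
  (forall a b, delta (a + b) = delta a + delta b) /\
  (forall a b, delta (a * b) = a * delta b + b * delta a).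

Record kalg (K : comPzRingType) := Kalg {
  kalg_ring :> comPzRingType;
  kalg_str : {rmorphism K -> kalg_ring} }.

Record kalgHom (K : comPzRingType) (R S : kalg K) := KalgHom {
  kalgHom_fun :> {rmorphism R -> S};
  kalgHom_str : forall a : K, kalgHom_fun (kalg_str R a) = kalg_str S a }.

Section Differentials.
Variables (K : comPzRingType) (delta : K -> K) (R : kalg K).

Inductive kahler_rel : mterm R R -> mterm R R -> Prop :=
| kahler_add (r s : R) :
    kahler_rel (MGen (r + s)) (MAdd (MGen r) (MGen s))
| kahler_mul (r s : R) :
    kahler_rel (MGen (r * s)) (MAdd (MScale r (MGen s)) (MScale s (MGen r)))
| kahler_const (a : K) :
    kahler_rel (MGen (kalg_str R a)) MZero.

Inductive tau_rel : mterm R R -> mterm R R -> Prop :=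
| tau_add (r s : R) :
    tau_rel (MGen (r + s)) (MAdd (MGen r) (MGen s))
| tau_mul (r s : R) :
    tau_rel (MGen (r * s)) (MAdd (MScale r (MGen s)) (MScale s (MGen r)))
| tau_delta (a b : K) :
    tau_rel (MScale (kalg_str R (delta a)) (MGen (kalg_str R b)))
            (MScale (kalg_str R (delta b)) (MGen (kalg_str R a))).

Definition Omega : lmodType R := pmod kahler_rel.
Definition Omega_tau : lmodType R := pmod tau_rel.

Definition diff (r : R) : Omega := pmod_gen kahler_rel r.
Definition tau (r : R) : Omega_tau := pmod_gen tau_rel r.

Lemma diffD r s : diff (r + s) = diff r + diff s.
Proof.
rewrite [in RHS]/GRing.add /= /diff /pmod_gen pmod_addE.
by apply/pmodP/mc_rel/kahler_add.
Qed.

Lemma diffM r s : diff (r * s) = r *: diff s + s *: diff r.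
Proof.
rewrite [in RHS]/GRing.add /= [in RHS]/GRing.scale /= /diff /pmod_gen.
by rewrite !pmod_scaleE pmod_addE; apply/pmodP/mc_rel/kahler_mul.
Qed.

Lemma diff_const a : diff (kalg_str R a) = 0.
Proof. by apply/pmodP/mc_rel/kahler_const. Qed.

Lemma tauD r s : tau (r + s) = tau r + tau s.
Proof.
rewrite [in RHS]/GRing.add /= /tau /pmod_gen pmod_addE.
by apply/pmodP/mc_rel/tau_add.
Qed.

Lemma tauM r s : tau (r * s) = r *: tau s + s *: tau r.
Proof.
rewrite [in RHS]/GRing.add /= [in RHS]/GRing.scale /= /tau /pmod_gen.
by rewrite !pmod_scaleE pmod_addE; apply/pmodP/mc_rel/tau_mul.
Qed.

Lemma tau_const a b :
  kalg_str R (delta a) *: tau (kalg_str R b)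
  = kalg_str R (delta b) *: tau (kalg_str R a).
Proof.
rewrite /GRing.scale /= /tau /pmod_gen !pmod_scaleE.
by apply/pmodP/mc_rel/tau_delta.
Qed.

End Differentials.

Section DifferentialsMap.
Variables (K : comPzRingType) (delta : K -> K) (R S : kalg K).
Variable phi : kalgHom R S.

Definition Omega_map : Omega R -> Omega S :=
  pmod_lift phi (fun r : R => diff (phi r)).

Lemma Omega_map_rel x y : kahler_rel x y ->
  meval phi (fun r : R => diff (phi r)) x
  = meval phi (fun r : R => diff (phi r)) y.
Proof.
case=> [r s|r s|a] /=; first by rewrite rmorphD diffD.
  by rewrite rmorphM diffM.
by rewrite kalgHom_str diff_const.
Qed.

Lemma Omega_map_diff r : Omega_map (diff r) = diff (phi r).
Proof. by rewrite /Omega_map pmod_lift_gen //; apply: Omega_map_rel. Qed.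

Lemma Omega_mapD : {morph Omega_map : x y / x + y}.
Proof. exact: pmod_liftD Omega_map_rel. Qed.

Lemma Omega_mapZ r x : Omega_map (r *: x) = phi r *: Omega_map x.
Proof. exact: pmod_liftZ Omega_map_rel _ _. Qed.

Definition Omega_tau_map : Omega_tau delta R -> Omega_tau delta S :=
  pmod_lift phi (fun r : R => tau delta (phi r)).

Lemma Omega_tau_map_rel x y : tau_rel delta x y ->
  meval phi (fun r : R => tau delta (phi r)) x
  = meval phi (fun r : R => tau delta (phi r)) y.
Proof.
case=> [r s|r s|a b] /=; first by rewrite rmorphD tauD.
  by rewrite rmorphM tauM.
by rewrite !kalgHom_str tau_const.
Qed.

Lemma Omega_tau_map_tau r : Omega_tau_map (tau delta r) = tau delta (phi r).
Proof. by rewrite /Omega_tau_map pmod_lift_gen //; apply: Omega_tau_map_rel. Qed.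

Lemma Omega_tau_mapD : {morph Omega_tau_map : x y / x + y}.
Proof. exact: pmod_liftD Omega_tau_map_rel. Qed.

Lemma Omega_tau_mapZ r x : Omega_tau_map (r *: x) = phi r *: Omega_tau_map x.
Proof. exact: pmod_liftZ Omega_tau_map_rel _ _. Qed.

End DifferentialsMap.

(* A covariant construction R |-> A(R) of commutative R-algebras, for K-algebras
   R; it prescribes the sections A(O_X(U)) of a sheaf of O_X-algebras on X over
   the affine open subsets U. *)
Record algFun (K : comPzRingType) := AlgFun {
  af_obj :> kalg K -> comPzRingType;
  af_str : forall R : kalg K, {rmorphism R -> af_obj R};
  af_map : forall R S : kalg K, kalgHom R S -> {rmorphism af_obj R -> af_obj S} }.

Definition symOmega (K : comPzRingType) : algFun K := {|
  af_obj := fun R => Sym (Omega R);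
  af_str := fun R => @Sym_const R (Omega R);
  af_map := fun R S phi => Sym_map (Omega_mapD phi) (Omega_mapZ phi) |}.

Definition symOmegaTau (K : comPzRingType) (delta : K -> K) : algFun K := {|
  af_obj := fun R => Sym (Omega_tau delta R);
  af_str := fun R => @Sym_const R (Omega_tau delta R);
  af_map := fun R S phi => Sym_map (@Omega_tau_mapD K delta R S phi)
                                   (@Omega_tau_mapZ K delta R S phi) |}.

Record primeSpec (R : comPzRingType) := PrimeIdeal {
  prime_set :> set R;
  prime0 : prime_set 0;
  primeD : forall a b, prime_set a -> prime_set b -> prime_set (a + b);
  primeMl : forall a b, prime_set b -> prime_set (a * b);
  prime1 : ~ prime_set 1;
  primeM : forall a b, prime_set (a * b) -> prime_set a \/ prime_set b }.

Section Zariski.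
Variable R : comPzRingType.

HB.instance Definition _ := gen_eqMixin (primeSpec R).
HB.instance Definition _ := gen_choiceMixin (primeSpec R).

Definition zariski_open (U : set (primeSpec R)) : Prop :=
  exists S : set R, U = [set p : primeSpec R | exists2 f, S f & ~ prime_set p f].

Lemma zariski_openT : zariski_open setT.
Proof.
exists [set 1]; apply/seteqP; split=> // p _ /=.
by exists 1 => //; exact: prime1.
Qed.

Lemma zariski_openI : setI_closed zariski_open.
Proof.
move=> _ _ [S ->] [T ->].
exists [set f | exists a b, [/\ S a, T b & f = a * b]].
apply/seteqP; split=> p /=.
  case=> -[a Sa pa] [b Tb pb]; exists (a * b); first by exists a, b.
  by case/primeM.
case=> _ [a [b [Sa Tb ->]]] pab; split.
  by exists a => // pa; apply: pab; rewrite mulrC; exact: primeMl.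
by exists b => // pb; apply: pab; exact: primeMl.
Qed.

Lemma zariski_open_bigU (I : Type) (f : I -> set (primeSpec R)) :
  (forall i, zariski_open (f i)) -> zariski_open (\bigcup_i f i).
Proof.
move=> /choice[S fS].
exists (\bigcup_i S i); apply/seteqP; split=> p /=.
  by case=> i _; rewrite fS => -[a Sa pa]; exists a => //; exists i.
by case=> a [i _ Sa] pa; exists i => //; rewrite fS; exists a.
Qed.

HB.instance Definition _ := isOpenTopological.Build (primeSpec R)
  zariski_openT zariski_openI zariski_open_bigU.

Definition basic_open (f : R) : set (primeSpec R) := [set p | ~ prime_set p f].

End Zariski.

(* [theta] exhibits B as the localization R_f. *)
Definition is_localization (R B : comPzRingType) (f : R)
    (theta : {rmorphism R -> B}) : Prop :=
  [/\ exists u, theta f * u = 1,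
      forall b, exists n r, b * theta f ^+ n = theta r
    & forall r, theta r = 0 -> exists n, f ^+ n * r = 0].

Record opens (X : topologicalType) := Opens {
  oset :> set X;
  oset_open : open oset }.

Definition openT_ (X : topologicalType) : opens X := Opens (@openT X).
Definition openI_ (X : topologicalType) (U V : opens X) : opens X :=
  Opens (openI (oset_open U) (oset_open V)).

Lemma preimage_open (X Y : topologicalType) (f : X -> Y) :
  continuous f -> forall V : opens Y, open (f @^-1` V).
Proof. by move=> /continuousP fc V; apply: fc; exact: oset_open. Qed.

Record ringedSpace := RingedSpace {
  space :> topologicalType;
  sect : opens space -> comPzRingType;
  res : forall U V : opens space, V `<=` U -> {rmorphism sect U -> sect V};
  res_id : forall (U : opens space) (h : U `<=` U) s, res h s = s;
  res_comp : forall (U V W : opens space) (h : V `<=` U) (k : W `<=` V) (l : W `<=` U) s,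
    res k (res h s) = res l s;
  sheaf_sep : forall (I : Type) (W : I -> opens space) (U : opens space)
      (inc : forall i, W i `<=` U),
    (U : set space) `<=` \bigcup_i W i ->
    forall s t : sect U, (forall i, res (inc i) s = res (inc i) t) -> s = t;
  sheaf_glue : forall (I : Type) (W : I -> opens space) (U : opens space)
      (inc : forall i, W i `<=` U),
    (U : set space) `<=` \bigcup_i W i ->
    forall s : (forall i, sect (W i)),
      (forall i j, res (@subIsetl _ (W i) (W j) : openI_ (W i) (W j) `<=` W i) (s i)
                 = res (@subIsetr _ (W i) (W j) : openI_ (W i) (W j) `<=` W j) (s j)) ->
      exists t : sect U, forall i, res (inc i) t = s i }.

Arguments sect X U : clear implicits, rename.

(* The germ of s at x is invertible in the stalk at x. *)
Definition unit_at (X : ringedSpace) (U : opens X) (x : X) (s : sect X U) : Prop :=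
  exists (V : opens X) (h : V `<=` U), oset V x /\ exists u, res h s * u = 1.

(* [mor_local] says that the ring homomorphisms induced on stalks are local. *)
Record mor (X Y : ringedSpace) := Mor {
  mor_fun :> X -> Y;
  mor_cont : continuous mor_fun;
  mor_pre := fun V : opens Y => Opens (preimage_open mor_cont V);
  mor_sh : forall V : opens Y, {rmorphism sect Y V -> sect X (mor_pre V)};
  mor_res : forall (U V : opens Y) (h : V `<=` U)
      (k : mor_pre V `<=` mor_pre U) (s : sect Y U),
    res k (mor_sh U s) = mor_sh V (res h s);
  mor_local : forall (V : opens Y) (s : sect Y V) (x : X),
    oset (mor_pre V) x -> unit_at x (mor_sh V s) -> unit_at (mor_fun x) s }.

Definition mor_pull (X Y : ringedSpace) (f : mor X Y) (V : opens Y) (U : opens X)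
    (h : U `<=` mor_pre f V) : {rmorphism sect Y V -> sect X U} :=
  res h \o mor_sh f V.

(* Equality of morphisms, stated without transport along f = g. *)
Definition mor_eq (X Y : ringedSpace) (f g : mor X Y) : Prop :=
  (forall x, f x = g x) /\
  (forall (V : opens Y) (U : opens X) (h : U `<=` mor_pre f V) (k : U `<=` mor_pre g V) s,
     mor_pull h s = mor_pull k s).

Section Composition.
Variables (X Y Z : ringedSpace) (g : mor Y Z) (f : mor X Y).

Lemma mor_comp_cont : continuous (g \o f).
Proof. by move=> x; apply: continuous_comp; exact: mor_cont. Qed.

Definition mor_comp_pre (V : opens Z) : opens X :=
  Opens (preimage_open mor_comp_cont V).

Lemma mor_comp_sub (V : opens Z) : mor_comp_pre V `<=` mor_pre f (mor_pre g V).
Proof. by []. Qed.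

Definition mor_comp_sh (V : opens Z) :
    {rmorphism sect Z V -> sect X (mor_comp_pre V)} :=
  mor_pull (@mor_comp_sub V) \o mor_sh g V.

Lemma mor_comp_res (U V : opens Z) (h : V `<=` U)
    (k : mor_comp_pre V `<=` mor_comp_pre U) (s : sect Z U) :
  res k (mor_comp_sh U s) = mor_comp_sh V (res h s).
Proof.
have k1 : mor_pre g V `<=` mor_pre g U by move=> y; exact: h.
have k2 : mor_pre f (mor_pre g V) `<=` mor_pre f (mor_pre g U).
  by move=> y; exact: h.
have k3 : mor_comp_pre V `<=` mor_pre f (mor_pre g U) by move=> y; exact: h.
rewrite /mor_comp_sh /mor_pull /= (res_comp _ _ k3).
by rewrite -(mor_res h k1) -(mor_res k1 k2) (res_comp _ _ k3).
Qed.

Lemma mor_comp_local (V : opens Z) (s : sect Z V) (x : X) :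
  oset (mor_comp_pre V) x -> unit_at x (mor_comp_sh V s) -> unit_at ((g \o f) x) s.
Proof.
move=> Vx [W [h [Wx [u us]]]]; apply: mor_local => //; apply: mor_local => //.
have h' : W `<=` mor_pre f (mor_pre g V) by move=> y /h.
exists W, h'; split=> //; exists u.
by rewrite -(res_comp (@mor_comp_sub V) h).
Qed.

Definition mor_comp : mor X Z :=
  @Mor X Z (g \o f) mor_comp_cont mor_comp_sh mor_comp_res mor_comp_local.

End Composition.

Section Identity.
Variable X : ringedSpace.

Lemma mor_id_cont : continuous (@id X).
Proof. by move=> x. Qed.

Definition mor_id_pre (V : opens X) : opens X := Opens (preimage_open mor_id_cont V).

Lemma mor_id_sub (V : opens X) : mor_id_pre V `<=` V.
Proof. by []. Qed.

Lemma mor_id_res (U V : opens X) (h : V `<=` U) (k : mor_id_pre V `<=` mor_id_pre U)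
    (s : sect X U) :
  res k (res (@mor_id_sub U) s) = res (@mor_id_sub V) (res h s).
Proof.
have l : mor_id_pre V `<=` U by move=> y; exact: h.
by rewrite (res_comp _ _ l) (res_comp _ _ l).
Qed.

Lemma mor_id_local (V : opens X) (s : sect X V) (x : X) :
  oset (mor_id_pre V) x -> unit_at x (res (@mor_id_sub V) s) -> unit_at x s.
Proof.
move=> Vx [W [h [Wx [u us]]]].
have h' : W `<=` V by move=> y /h.
by exists W, h'; split=> //; exists u; rewrite -(res_comp (@mor_id_sub V) h).
Qed.

Definition mor_id : mor X X :=
  @Mor X X id mor_id_cont (fun V => res (@mor_id_sub V)) mor_id_res mor_id_local.

End Identity.

(* (U, O_X|U) is isomorphic to (Spec R, O_{Spec R}), by a homeomorphism
   h : Spec R -> U and an identification of the sections over h(D(f)) with R_f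
   for all f in R. This determines O_X|U, since O_{Spec R} is the unique sheaf
   with sections R_f over D(f) and the localization maps as restrictions. *)
Definition affine_chart (X : ringedSpace) (U : opens X) (R : comPzRingType)
    (h : primeSpec R -> X) (theta : {rmorphism R -> sect X U}) : Prop :=
  [/\ injective h,
      range h = U,
      forall W : set (primeSpec R), open W <-> open (h @` W)
    & forall (f : R) (V : opens X) (k : V `<=` U),
        (V : set X) = h @` basic_open f ->
        is_localization f (res k \o theta)].

Definition affine (X : ringedSpace) (U : opens X) : Prop :=
  exists (R : comPzRingType) (h : primeSpec R -> X)
    (theta : {rmorphism R -> sect X U}), affine_chart h theta.

Record scheme := Scheme {
  scheme_space :> ringedSpace;
  scheme_affine : forall x : scheme_space,
    exists U : opens scheme_space, affine U /\ oset U x }.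

Definition closed_immersion (Z Y : scheme) (i : mor Z Y) : Prop :=
  [/\ injective i,
      closed (range i),
      forall W : opens Z, exists V : opens Y, (W : set Z) = i @^-1` V
    & forall (V : opens Y) (s : sect Z (mor_pre i V)) (y : Y), oset V y ->
        exists (V' : opens Y) (h : V' `<=` V) (k : mor_pre i V' `<=` mor_pre i V)
               (t : sect Y V'),
          oset V' y /\ mor_sh i V' t = res k s].

(* A morphism to Spec K is encoded by the corresponding ring homomorphism from K
   to the global sections. *)
Record kscheme (K : comPzRingType) := Kscheme {
  ksch :> scheme;
  ksch_str : {rmorphism K -> sect ksch (openT_ ksch)} }.

Definition sectAlg (K : comPzRingType) (X : kscheme K) (U : opens X) : kalg K :=
  Kalg (res (@subsetT _ U : U `<=` openT_ X) \o ksch_str X).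

Record kmor (K : comPzRingType) (X Y : kscheme K) := Kmor {
  kmor_mor :> mor X Y;
  kmor_str : forall a : K,
    mor_sh kmor_mor (openT_ Y) (ksch_str Y a)
    = kalg_str (sectAlg (mor_pre kmor_mor (openT_ Y))) a }.

Definition is_kproduct (K : comPzRingType) (X P : kscheme K)
    (pr1 pr2 : kmor P X) : Prop :=
  forall (Z : kscheme K) (f g : kmor Z X),
    (exists u : kmor Z P,
        mor_eq (mor_comp pr1 u) f /\ mor_eq (mor_comp pr2 u) g) /\
    (forall u v : kmor Z P,
        mor_eq (mor_comp pr1 u) (mor_comp pr1 v) ->
        mor_eq (mor_comp pr2 u) (mor_comp pr2 v) -> mor_eq u v).

Definition separated (K : comPzRingType) (X : kscheme K) : Prop :=
  exists (P : kscheme K) (pr1 pr2 : kmor P X) (diag : kmor X P),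
    [/\ is_kproduct pr1 pr2,
        mor_eq (mor_comp pr1 diag) (mor_id X),
        mor_eq (mor_comp pr2 diag) (mor_id X)
      & closed_immersion diag].

Definition integral (X : scheme) : Prop :=
  inhabited X /\
  (forall U : opens X, (exists x, oset U x) ->
     (1 : sect X U) <> 0 /\
     (forall a b : sect X U, a * b = 0 -> a = 0 \/ b = 0)).

Definition fg_kalg (K : comPzRingType) (R : kalg K) : Prop :=
  exists gens : seq R, forall P : set R,
    (forall a, P (kalg_str R a)) ->
    (forall g, g \in gens -> P g) ->
    (forall a b, P a -> P b -> P (a + b)) ->
    (forall a b, P a -> P b -> P (a * b)) ->
    forall r, P r.

Definition finite_type (K : comPzRingType) (X : kscheme K) : Prop :=
  exists (n : nat) (U : 'I_n -> opens X),
    (forall x : X, exists i, oset (U i) x) /\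
    (forall i, affine (U i) /\ fg_kalg (sectAlg (U i))).

Record variety (K : comPzRingType) := Variety {
  var_ksch :> kscheme K;
  var_integral : integral var_ksch;
  var_separated : separated var_ksch;
  var_finite_type : finite_type var_ksch }.

Section PullHom.
Variables (K : comPzRingType).

Lemma resHom_str (X : kscheme K) (U V : opens X) (h : V `<=` U) (a : K) :
  res h (kalg_str (sectAlg U) a) = kalg_str (sectAlg V) a.
Proof. exact: res_comp. Qed.

Definition resHom (X : kscheme K) (U V : opens X) (h : V `<=` U) :
    kalgHom (sectAlg U) (sectAlg V) :=
  @KalgHom K (sectAlg U) (sectAlg V) (res h) (resHom_str h).

Lemma pullHom_str (X Y : kscheme K) (f : kmor X Y) (V : opens Y) (U : opens X)
    (h : U `<=` mor_pre f V) (a : K) :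
  mor_pull h (kalg_str (sectAlg V) a) = kalg_str (sectAlg U) a.
Proof.
have k : mor_pre f V `<=` mor_pre f (openT_ Y) by [].
have l : U `<=` mor_pre f (openT_ Y) by [].
rewrite /mor_pull /= -(mor_res _ k) (res_comp _ _ l) kmor_str.
exact: res_comp.
Qed.

Definition pullHom (X Y : kscheme K) (f : kmor X Y) (V : opens Y) (U : opens X)
    (h : U `<=` mor_pre f V) : kalgHom (sectAlg V) (sectAlg U) :=
  @KalgHom K (sectAlg V) (sectAlg U) (mor_pull h) (pullHom_str h).

End PullHom.

(* A relative spectrum over X of the quasi-coherent sheaf of O_X-algebras with
   sections A(O_X(U)) over the affine open subsets U: an affine X-scheme p : S -> X
   with O_X-algebra isomorphisms A(O_X(U)) = O_S(p^-1 U) compatible with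
   restrictions. It is unique up to a unique isomorphism. *)
Record relSpec (K : comPzRingType) (A : algFun K) (X : kscheme K) := RelSpec {
  rs_scheme :> scheme;
  rs_proj : mor rs_scheme X;
  rs_affine : forall U : opens X, affine U -> affine (mor_pre rs_proj U);
  rs_iso : forall U : opens X, affine U ->
    {rmorphism A (sectAlg U) -> sect rs_scheme (mor_pre rs_proj U)};
  rs_bij : forall (U : opens X) (aU : affine U), bijective (rs_iso aU);
  rs_str : forall (U : opens X) (aU : affine U) (r : sectAlg U),
    rs_iso aU (af_str A (sectAlg U) r) = mor_sh rs_proj U r;
  rs_res : forall (U V : opens X) (aU : affine U) (aV : affine V) (h : V `<=` U)
      (k : mor_pre rs_proj V `<=` mor_pre rs_proj U) (a : A (sectAlg U)),
    res k (rs_iso aU a) = rs_iso aV (af_map A (resHom h) a) }.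

(* F is the morphism between the relative spectra that is induced by the
   K-morphism f: it lies over f and, for U in X and V in Y affine open with f(U)
   contained in V, it corresponds to A(O_Y(V)) -> A(O_X(U)). *)
Definition rs_induced (K : comPzRingType) (A : algFun K) (X Y : kscheme K)
    (f : kmor X Y) (SX : relSpec A X) (SY : relSpec A Y) (F : mor SX SY) : Prop :=
  mor_eq (mor_comp (rs_proj SY) F) (mor_comp f (rs_proj SX)) /\
  (forall (U : opens X) (V : opens Y) (aU : affine U) (aV : affine V)
      (h : U `<=` mor_pre f V)
      (k : mor_pre (rs_proj SX) U `<=` mor_pre F (mor_pre (rs_proj SY) V))
      (a : A (sectAlg V)),
    mor_pull k (rs_iso SY aV a) = rs_iso SX aU (af_map A (pullHom h) a)).

Definition tangentVariety (K : comPzRingType) (X : kscheme K) :=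
  relSpec (symOmega K) X.
Definition prolongationCone (K : comPzRingType) (delta : K -> K) (X : kscheme K) :=
  relSpec (symOmegaTau delta) X.

(* Main.v *)
From HB Require Import structures.
Require Import Defs.
From mathcomp Require Import all_boot all_order all_algebra.
From mathcomp Require Import generic_quotient.
From mathcomp Require Import all_classical topology.

(** The symbols d r of the Kaehler differentials satisfy all relations imposed
    on the symbols tau r: additivity and the Leibniz rule are the same, and
    delta(a) d b = delta(b) d a holds because both sides vanish for constants
    a and b. So tau r |-> d r defines a surjective R-linear map from the module
    of tau-differentials of R onto the module of Kaehler differentials of R.
    It is natural in the K-algebra R, and so is the induced surjection between
    the symmetric algebras, [sym_tau_to_kahler]. Over an affine open subset of
    X, a surjective ring homomorphism is a closed immersion of spectra in the
    opposite direction, from TX to CX; by naturality these closed immersions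
    agree on overlaps and commute with the morphisms induced by a morphism of
    varieties.

    The rest of the proof is the dictionary between schemes and rings on which
    that argument relies. Throughout, a point x of an affine open subset U is
    handled through the set of sections over U that are invertible at x: it is
    the complement of a prime ideal, and each prime ideal arises from exactly
    one point ([affine_point], [affine_point_eq]). Three facts carry the
    argument:
    - [mor_glue]: compatible ring homomorphisms from the sections over affine
      open subsets of Y come from a morphism to Y. A point z goes to the point
      where s is invertible exactly when the image of s is invertible at z. A
      section over an arbitrary open subset is locally a fraction c / f of
      sections over one of the given affine subsets, and its pullback is the
      fraction of the images; that this does not depend on the fraction is
      the statement that a section vanishing near a point is killed by a
      section that is invertible there.
    - [mor_eq_local]: for the same reasons a morphism to a scheme is determined
      by its action on the sections over affine open subsets. This gives that
      the embedding lies over X and that it is natural in X.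
    - [closed_immersion_affine]: closed immersions can be recognized on affine
      open subsets of the target, by surjectivity on sections.
    To compare two affine open subsets, one uses that the affine open subsets
    form a base ([affine_nbhs]). *)

Set Implicit Arguments.
Unset Strict Implicit.
Unset Printing Implicit Defensive.

Import GRing.Theory.
Local Open Scope quotient_scope.
Local Open Scope classical_set_scope.
Local Open Scope ring_scope.

(** * From tau-differentials to Kaehler differentials *)

(** Induction on the terms that represent the elements of a presented module:
    it reduces statements about additive maps to the generators. *)
Lemma pmod_ind (R : comPzRingType) (G : Type)
    (rel : mterm R G -> mterm R G -> Prop) (P : pmod rel -> Prop) :
  P 0 -> (forall x y, P x -> P y -> P (x + y)) -> (forall x, P x -> P (- x)) ->
  (forall r x, P x -> P (r *: x)) -> (forall g, P (pmod_gen rel g)) ->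
  forall x, P x.
Proof.
move=> P0 PD PN PZ Pg; elim/quotW; elim=> [//|x Px y Py|x Px|r x Px|g].
- by move: (PD _ _ Px Py); rewrite /GRing.add /= pmod_addE.
- by move: (PN _ Px); rewrite /GRing.opp /= pmod_oppE.
- by move: (PZ r _ Px); rewrite /GRing.scale /= pmod_scaleE.
exact: Pg.
Qed.

Lemma Sym_ind (R : comPzRingType) (M : lmodType R) (P : Sym M -> Prop) :
  (forall r, P (Sym_const M r)) -> (forall m, P (Sym_gen m)) ->
  (forall x y, P x -> P y -> P (x + y)) -> (forall x, P x -> P (- x)) ->
  (forall x y, P x -> P y -> P (x * y)) ->
  forall x, P x.
Proof.
move=> Pc Pg PD PN PM; elim/quotW.
elim=> [r|m|x Px y Py|x Px|x Px y Py]; [exact: Pc|exact: Pg|..].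
- by move: (PD _ _ Px Py); rewrite /GRing.add /= Sym_addE.
- by move: (PN _ Px); rewrite /GRing.opp /= Sym_oppE.
by move: (PM _ _ Px Py); rewrite /GRing.mul /= Sym_mulE.
Qed.

Lemma morph_add0 (A B : zmodType) (f : A -> B) :
  {morph f : x y / x + y} -> f 0 = 0.
Proof. by move=> fD; apply: (addIr (f 0)); rewrite -fD !add0r. Qed.

Lemma morph_addN (A B : zmodType) (f : A -> B) :
  {morph f : x y / x + y} -> {morph f : x / - x}.
Proof.
move=> fD x; apply: (addIr (f x)); rewrite -fD !addNr; exact: morph_add0.
Qed.

Section TauToKahler.
Variables (K : comPzRingType) (delta : K -> K).
Implicit Types R S : kalg K.

(** The relation delta(a) tau b = delta(b) tau a holds for d because d kills
    constants; the other relations are those of d itself. *)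
Lemma diff_tau_rel R x y : tau_rel delta x y ->
  meval (idfun : {rmorphism R -> R}) (@diff K R) x = meval idfun (@diff K R) y.
Proof.
case=> [r s|r s|a b] /=; [exact: diffD | exact: diffM |].
by rewrite !diff_const !scaler0.
Qed.

Definition tau_to_kahler R : Omega_tau delta R -> Omega R :=
  pmod_lift (idfun : {rmorphism R -> R}) (@diff K R).

Lemma tau_to_kahler_tau R r : @tau_to_kahler R (tau delta r) = diff r.
Proof. by rewrite /tau_to_kahler pmod_lift_gen //; exact: diff_tau_rel. Qed.

Lemma tau_to_kahlerD R : {morph @tau_to_kahler R : x y / x + y}.
Proof. exact: pmod_liftD (@diff_tau_rel R). Qed.

Lemma tau_to_kahlerZ R r x : @tau_to_kahler R (r *: x) = r *: tau_to_kahler x.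
Proof. exact: pmod_liftZ (@diff_tau_rel R) _ _. Qed.

Lemma tau_to_kahler_onto R x : exists y, @tau_to_kahler R y = x.
Proof.
elim/pmod_ind: x => [|_ _ [x <-] [y <-]|_ [x <-]|r _ [x <-]|r].
- by exists 0; exact: morph_add0 (@tau_to_kahlerD R).
- by exists (x + y); exact: tau_to_kahlerD.
- by exists (- x); exact: morph_addN (@tau_to_kahlerD R) _.
- by exists (r *: x); exact: tau_to_kahlerZ.
by exists (tau delta r); exact: tau_to_kahler_tau.
Qed.

Lemma tau_to_kahler_nat R S (phi : kalgHom R S) x :
  tau_to_kahler (Omega_tau_map phi x) = Omega_map phi (@tau_to_kahler R x).
Proof.
elim/pmod_ind: x => [|x y IHx IHy|x IHx|r x IHx|r].
- rewrite (morph_add0 (@Omega_tau_mapD K delta R S phi)).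
  rewrite !(morph_add0 (@tau_to_kahlerD _)).
  by rewrite (morph_add0 (@Omega_mapD K R S phi)).
- by rewrite Omega_tau_mapD !tau_to_kahlerD Omega_mapD IHx IHy.
- rewrite (morph_addN (@Omega_tau_mapD K delta R S phi)).
  rewrite !(morph_addN (@tau_to_kahlerD _)).
  by rewrite (morph_addN (@Omega_mapD K R S phi)) IHx.
- by rewrite Omega_tau_mapZ !tau_to_kahlerZ Omega_mapZ IHx.
by rewrite Omega_tau_map_tau !tau_to_kahler_tau Omega_map_diff.
Qed.

Definition sym_tau_to_kahler R :
    {rmorphism symOmegaTau delta R -> symOmega K R} :=
  @Sym_map R R idfun _ _ _ (@tau_to_kahlerD R) (@tau_to_kahlerZ R).

Lemma sym_tau_to_kahler_const R (r : R) :
  sym_tau_to_kahler R (af_str (symOmegaTau delta) R r)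
  = af_str (symOmega K) R r.
Proof. exact: Sym_lift_const. Qed.

Lemma sym_tau_to_kahler_gen R m :
  sym_tau_to_kahler R (Sym_gen m) = Sym_gen (tau_to_kahler m).
Proof. exact: Sym_lift_gen. Qed.

Lemma sym_tau_to_kahler_onto R x : exists y, sym_tau_to_kahler R y = x.
Proof.
elim/Sym_ind: x => [r|m|_ _ [x <-] [y <-]|_ [x <-]|_ _ [x <-] [y <-]].
- by exists (af_str (symOmegaTau delta) R r); exact: sym_tau_to_kahler_const.
- have [n <-] := tau_to_kahler_onto m.
  by exists (Sym_gen n); exact: sym_tau_to_kahler_gen.
- by exists (x + y); exact: rmorphD.
- by exists (- x); exact: rmorphN.
by exists (x * y); exact: rmorphM.
Qed.

Lemma sym_tau_to_kahler_nat R S (phi : kalgHom R S) x :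
  sym_tau_to_kahler S (af_map (symOmegaTau delta) phi x)
  = af_map (symOmega K) phi (sym_tau_to_kahler R x).
Proof.
elim/Sym_ind: x => [r|m|x y IHx IHy|x IHx|x y IHx IHy].
- rewrite sym_tau_to_kahler_const.
  rewrite [af_map (symOmegaTau delta) phi _]Sym_lift_const.
  rewrite [af_map (symOmega K) phi _]Sym_lift_const.
  exact: sym_tau_to_kahler_const.
- rewrite sym_tau_to_kahler_gen.
  rewrite [af_map (symOmegaTau delta) phi _]Sym_lift_gen.
  rewrite [af_map (symOmega K) phi _]Sym_lift_gen /=.
  by rewrite -tau_to_kahler_nat; exact: sym_tau_to_kahler_gen.
- by rewrite !rmorphD IHx IHy.
- by rewrite !rmorphN IHx.
by rewrite !rmorphM IHx IHy.
Qed.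

End TauToKahler.

(** The isomorphisms of sections over p^-1 U with an algebra are only known to
    be bijective, so their inverses are taken through this factorization. *)
Lemma rmorph_factor (A B C : comPzRingType) (f : {rmorphism A -> B})
    (g : {rmorphism A -> C}) :
  bijective f -> exists h : {rmorphism B -> C}, forall a, h (f a) = g a.
Proof.
move=> [f' fK f'K]; pose h := g \o f'.
have h_nmod : nmod_morphism h.
  split=> [|x y] /=; first by rewrite /h /= -(rmorph0 f) fK rmorph0.
  by rewrite /h /= -rmorphD; congr (g _); apply: (can_inj fK); rewrite rmorphD !f'K.
have h_monoid : monoid_morphism h.
  split=> [|x y] /=; first by rewrite /h /= -(rmorph1 f) fK rmorph1.
  by rewrite /h /= -rmorphM; congr (g _); apply: (can_inj fK); rewrite rmorphM !f'K.
pose H : {rmorphism B -> C} := HB.pack h (GRing.isNmodMorphism.Build _ _ _ h_nmod)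
    (GRing.isMonoidMorphism.Build _ _ _ h_monoid).
by exists H => a; rewrite /= /h /= fK.
Qed.

(** * Sections and units *)

Section Sheaf.
Variable X : ringedSpace.
Implicit Types U V W : opens X.

(** Sections over different open sets live in different types, so that equal
    open sets are compared by restricting along inclusions in either direction;
    the proof of the inclusion is irrelevant. *)
Lemma eq_res U V (h h' : V `<=` U) (s : sect X U) : res h s = res h' s.
Proof. by rewrite (Prop_irrelevance h h'). Qed.

Lemma res_res U V W (h : V `<=` U) (k : W `<=` V) (s : sect X U) :
  res k (res h s) = res (subset_trans k h) s.
Proof. exact: res_comp. Qed.

Lemma sect_eq_local U (s t : sect X U) :
  (forall x, oset U x ->
     exists V (h : V `<=` U), oset V x /\ res h s = res h t) ->
  s = t.
Proof.
move=> st.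
pose I := {V : opens X & {h : V `<=` U | res h s = res h t}}.
apply: (@sheaf_sep X I (fun i => projT1 i) U (fun i => sval (projT2 i))).
  move=> x /st[V [h [Vx e]]].
  by exists (existT _ V (exist _ h e)).
by move=> [V [h e]].
Qed.

(** A property Q that determines a section and is stable under restriction
    makes local solutions agree on overlaps, so that they glue. *)
Lemma sect_glue_local U (Q : forall W, sect X W -> Prop) :
  (forall V W (h : W `<=` V) s, Q V s -> Q W (res h s)) ->
  (forall W s s', W `<=` U -> Q W s -> Q W s' -> s = s') ->
  (forall x, oset U x -> exists W, [/\ W `<=` U, oset W x & exists s, Q W s]) ->
  exists t : sect X U, forall W (h : W `<=` U) s, Q W s -> res h t = s.
Proof.
move=> Qres Quniq Qex.
pose I := {W : opens X & {s : sect X W | W `<=` U /\ Q W s}}.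
pose inc (i : I) : projT1 i `<=` U := proj1 (svalP (projT2 i)).
have [||t tP] := @sheaf_glue X I (fun i => projT1 i) U inc _
    (fun i => sval (projT2 i)).
- move=> x /Qex[W [WU Wx [s Qs]]].
  by exists (existT _ W (exist _ s (conj WU Qs))).
- move=> [V [s [VU Qs]]] [W [s' [WU Qs']]] /=.
  by apply: Quniq; [move=> x [/VU] | exact: Qres..].
exists t => W h s Qs.
have := tP (existT _ W (exist _ s (conj h Qs))).
by rewrite /= (eq_res _ h).
Qed.

Lemma unit_at_in U x (s : sect X U) : unit_at x s -> oset U x.
Proof. by case=> V [h [/h]]. Qed.

(** Being invertible at x depends only on the germ at x. *)
Lemma unit_at_res U V (h : V `<=` U) x (s : sect X U) :
  oset V x -> unit_at x (res h s) <-> unit_at x s.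
Proof.
move=> Vx; split=> -[W [k [Wx [u su]]]].
  exists W, (subset_trans k h); split=> //; exists u.
  by rewrite -su res_res.
have kW : openI_ V W `<=` W by move=> y [].
have kV : openI_ V W `<=` V by move=> y [].
exists (openI_ V W), kV; split=> //.
exists (res kW u); rewrite res_res (eq_res _ (subset_trans kW k)) -res_res.
by rewrite -rmorphM su rmorph1.
Qed.

Lemma unit_at_inv U x (s u : sect X U) : oset U x -> s * u = 1 -> unit_at x s.
Proof.
move=> Ux su; exists U, (@subset_refl _ U); split=> //.
by exists (res (@subset_refl _ U) u); rewrite -rmorphM su rmorph1.
Qed.

Lemma unit_at1 U x : oset U x -> unit_at x (1 : sect X U).
Proof. by move=> Ux; apply: (@unit_at_inv _ _ _ 1) => //; rewrite mulr1. Qed.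

(** A factor of a unit is a unit, and two units at x have inverses on a common
    neighborhood of x. *)
Lemma unit_atM U x (s t : sect X U) :
  unit_at x (s * t) <-> unit_at x s /\ unit_at x t.
Proof.
split.
  case=> V [h [Vx [u e]]]; rewrite rmorphM in e.
  split; apply/(unit_at_res h) => //.
    by apply: (@unit_at_inv _ _ _ (res h t * u)) => //; rewrite mulrA.
  apply: (@unit_at_inv _ _ _ (res h s * u)) => //.
  by rewrite mulrCA mulrA.
case=> -[V [h [Vx [u e]]]] [W [k [Wx [v f]]]].
have lV : openI_ V W `<=` V by move=> y [].
have lW : openI_ V W `<=` W by move=> y [].
have l : openI_ V W `<=` U by move=> y /lV/h.
apply/(unit_at_res l) => //.
apply: (@unit_at_inv _ _ _ (res lV u * res lW v)) => //.
rewrite rmorphM mulrACA -(res_comp h lV) -(res_comp k lW) -!rmorphM.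
by rewrite e f !rmorph1 mulr1.
Qed.

Lemma unit_atX U x (s : sect X U) n : unit_at x s -> unit_at x (s ^+ n).
Proof.
move=> us; elim: n => [|n IHn]; first exact/unit_at1/(unit_at_in us).
by rewrite exprS; apply/unit_atM.
Qed.

(** Inverses are unique, so local ones glue. *)
Lemma unit_atP U (s : sect X U) :
  (forall x, oset U x -> unit_at x s) -> exists u, s * u = 1.
Proof.
move=> us.
pose Q W (u : sect X W) := exists h : W `<=` U, res h s * u = 1.
have [||| u uP] := @sect_glue_local U Q.
- move=> V W k u [h e]; exists (subset_trans k h).
  by rewrite -res_res -rmorphM e rmorph1.
- move=> W u v _ [h e] [k f]; rewrite (eq_res _ k) in e.
  by rewrite -[u]mulr1 -f mulrCA mulrA e mul1r.
- move=> x /us[V [h [Vx [u e]]]]; exists V; split=> //.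
  by exists u, h.
exists u; apply: sect_eq_local => x /us[V [h [Vx [v e]]]].
exists V, h; split=> //; rewrite rmorphM rmorph1 (uP _ _ v) //.
by exists h.
Qed.

Lemma unit_at_cancel_local U (s t f : sect X U) :
  (forall x, oset U x -> unit_at x f) -> s * f = t * f -> s = t.
Proof.
move=> /unit_atP[u fu] st.
by rewrite -[s]mulr1 -[t]mulr1 -fu !mulrA st.
Qed.

Lemma unit_locus_open U (s : sect X U) : open [set x | unit_at x s].
Proof.
rewrite (_ : mkset _ =
  \bigcup_(V in [set V : opens X |
     exists (h : V `<=` U) u, res h s * u = 1]) V).
  by apply: bigcup_open => V _; exact: oset_open.
apply/seteqP; split=> x /=.
  by case=> V [h [Vx [u e]]]; exists V => //; exists h, u.
by case=> V [h [u e]] Vx; exists V, h; split=> //; exists u.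
Qed.

(** The distinguished open set D(s), for a section s over any open set. *)
Definition unit_locus U (s : sect X U) : opens X := Opens (unit_locus_open s).

Lemma unit_locus_sub U (s : sect X U) : unit_locus s `<=` U.
Proof. by move=> x /unit_at_in. Qed.

End Sheaf.

(** * Affine open subsets *)

Section Primes.
Variable R : comPzRingType.
Implicit Types p q : primeSpec R.

Lemma primeSpec_eq p q : (forall a, prime_set p a <-> prime_set q a) -> p = q.
Proof.
case: p q => [P p0 pD pM p1 pP] [Q q0 qD qM q1 qP] /= PQ.
have PeqQ : P = Q by apply/seteqP; split=> a /PQ.
by subst Q; congr PrimeIdeal; exact: Prop_irrelevance.
Qed.

Lemma prime_mulE p a b : prime_set p (a * b) <-> prime_set p a \/ prime_set p b.
Proof.
split; first exact: primeM.
by case=> ?; [rewrite mulrC|]; exact: primeMl.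
Qed.

Lemma primeX p a n : prime_set p (a ^+ n) -> prime_set p a.
Proof.
elim: n => [/prime1//|n IHn]; rewrite exprS.
by case/primeM.
Qed.

Lemma basic_open_open (f : R) : open (basic_open f).
Proof.
exists [set f]; apply/seteqP; split=> p /=.
  by move=> pf; exists f.
by case=> g ->.
Qed.

Lemma basic_openX (f : R) n : basic_open (f ^+ n.+1) = basic_open f.
Proof.
apply/seteqP; split=> p /= pf.
  by move=> ?; apply: pf; rewrite exprSr; exact: primeMl.
by move/primeX.
Qed.

Lemma basic_open_base (W : set (primeSpec R)) p : open W -> W p ->
  exists2 f, ~ prime_set p f & basic_open f `<=` W.
Proof.
by move=> [S ->] [f Sf pf]; exists f => // q qf; exists f.
Qed.

End Primes.

Definition prime_comap (R S : comPzRingType) (f : {rmorphism R -> S})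
  (P : primeSpec S) : primeSpec R.
Proof.
refine (@PrimeIdeal R [set r | prime_set P (f r)] _ _ _ _ _) => /=.
- by rewrite rmorph0; exact: prime0.
- by move=> a b; rewrite rmorphD; exact: primeD.
- by move=> a b; rewrite rmorphM; exact: primeMl.
- by rewrite rmorph1; exact: prime1.
by move=> a b; rewrite rmorphM; exact: primeM.
Defined.

Section Chart.
Variables (X : ringedSpace) (U : opens X) (R : comPzRingType).
Variables (h : primeSpec R -> X) (theta : {rmorphism R -> sect X U}).
Hypothesis c : affine_chart h theta.

Lemma chart_in p : oset U (h p).
Proof. by case: c => _ hU _ _; rewrite -hU; exists p. Qed.

Lemma chart_onto x : oset U x -> exists p, h p = x.
Proof. by case: c => _ hU _ _; rewrite -hU => -[p _ <-]; exists p. Qed.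

Lemma chart_basic_open f : open (h @` basic_open f).
Proof. by case: c => _ _ o _; apply/o/basic_open_open. Qed.

Lemma chart_basic_sub f : h @` basic_open f `<=` U.
Proof. by move=> _ [p _ <-]; exact: chart_in. Qed.

Lemma chart_loc f (V : opens X) (k : V `<=` U) :
  (V : set X) = h @` basic_open f -> is_localization f (res k \o theta).
Proof. by case: c => _ _ _; exact. Qed.

Lemma chart_base (V : opens X) p : oset V (h p) ->
  exists2 f, ~ prime_set p f & h @` basic_open f `<=` V.
Proof.
move=> Vp; have [_ hU ho _] := c.
have oW : open (h @^-1` V).
  apply/ho; rewrite [X in open X](_ : _ = (U : set X) `&` V).
    by apply: openI; exact: oset_open.
  rewrite -hU; apply/seteqP; split=> x.
    by move=> [q Vq <-]; split=> //; exists q.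
  by move=> [[q _ <-] Vq]; exists q.
have [f pf fV] := basic_open_base oW Vp.
by exists f => // x [q fq <-]; exact: (fV q fq).
Qed.

(** A section that is invertible near the point p becomes, over a small D(g), a
    factor of a power of g in R up to localization at g; as g is not in p, the
    section is not in p. *)
Lemma chart_unit p r : unit_at (h p) (theta r) <-> ~ prime_set p r.
Proof.
have [hI _ _ _] := c.
split=> [[V [k [Vp [u e]]]] pr|pr].
  have [g pg gV] := chart_base Vp.
  pose W := Opens (chart_basic_open g).
  have gU : W `<=` U by exact: chart_basic_sub.
  have [_ frac ker] := @chart_loc g W gU erefl.
  have [n [a ae]] := frac (res (gV : W `<=` V) u).
  have [|m me] := ker (r * a - g ^+ n).
    rewrite rmorphB rmorphM -ae rmorphXn mulrA /= -(res_comp k (gV : W `<=` V)).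
    by rewrite -rmorphM e rmorph1 mul1r subrr.
  have : prime_set p (g ^+ m * g ^+ n).
    have -> : g ^+ m * g ^+ n = g ^+ m * a * r.
      by apply/esym/eqP; rewrite -subr_eq0 -mulrA [a * r]mulrC -mulrBr me.
    exact: primeMl.
  by rewrite -exprD => /primeX.
pose W := Opens (chart_basic_open r).
have rU : W `<=` U by exact: chart_basic_sub.
have [[u e] _ _] := @chart_loc r W rU erefl.
exists W, rU; split; first by exists p.
by exists u.
Qed.

(** U is D(1), and localizing at 1 changes nothing. *)
Lemma chart_sect_onto (s : sect X U) : exists r, theta r = s.
Proof.
have [_ hU _ _] := c.
have [_ frac _] : is_localization 1 (res (@subset_refl _ U) \o theta).
  apply: chart_loc; rewrite -hU; congr (_ @` _).
  by apply/seteqP; split=> // p _; exact: prime1.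
have [n [r e]] := frac s; exists r.
by move: e; rewrite rmorph1 expr1n mulr1 /= res_id => ->.
Qed.

Lemma chart_frac p (V : opens X) (s : sect X V) : oset V (h p) ->
  exists f a (W : opens X) (k : W `<=` V) (l : W `<=` U),
    [/\ ~ prime_set p f, (W : set X) = h @` basic_open f
      & res k s * res l (theta f) = res l (theta a)].
Proof.
move=> /chart_base[f pf fV].
pose W := Opens (chart_basic_open f).
have l : W `<=` U by exact: chart_basic_sub.
have [_ frac _] := @chart_loc f W l erefl.
have [n [a e]] := frac (res (fV : W `<=` V) s).
(* The exponent n.+1 is used because D(f ^+ 0) would be all of U. *)
exists (f ^+ n.+1), (a * f), W, fV, l; split.
- by move/primeX.
- by rewrite basic_openX.
rewrite exprSr !rmorphM mulrA; congr (_ * _).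
by rewrite !rmorphXn; exact: e.
Qed.

Lemma chart_zero p (V : opens X) (l : V `<=` U) r : oset V (h p) ->
  res l (theta r) = 0 -> exists2 g, ~ prime_set p g & g * r = 0.
Proof.
move=> /chart_base[f pf fV] r0.
pose W := Opens (chart_basic_open f).
have k : W `<=` U by exact: chart_basic_sub.
have [_ _ ker] := @chart_loc f W k erefl.
have [|n e] := ker r; first by rewrite /= -(res_comp l (fV : W `<=` V)) r0 rmorph0.
by exists (f ^+ n) => // /primeX.
Qed.

(** The stalk at h p is a local ring: two sections have a common denominator
    near h p, and the numerators that are not invertible form the prime p. *)
Lemma chart_unit_atD p (V : opens X) (s t : sect X V) :
  unit_at (h p) (s + t) -> unit_at (h p) s \/ unit_at (h p) t.
Proof.
move=> ust; have Vp := unit_at_in ust.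
have [f [a [W [k [l [pf eW e]]]]]] := chart_frac s Vp.
have [g [b [W' [k' [l' [pg eW' e']]]]]] := chart_frac t Vp.
have Wp : oset W (h p) by rewrite eW; exists p.
have Wp' : oset W' (h p) by rewrite eW'; exists p.
pose I := openI_ W W'.
have Ip : oset I (h p) by [].
have iW : I `<=` W by move=> x [].
have iW' : I `<=` W' by move=> x [].
have iU : I `<=` U by move=> x /iW/l.
have iV : I `<=` V by move=> x /iW/k.
have {}e : res iV s * res iU (theta f) = res iU (theta a).
  by rewrite -(res_comp k iW) -!(res_comp l iW) -rmorphM e.
have {}e' : res iV t * res iU (theta g) = res iU (theta b).
  by rewrite -(res_comp k' iW') -!(res_comp l' iW') -rmorphM e'.
have uf : unit_at (h p) (res iU (theta f)) by apply/unit_at_res/chart_unit.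
have ug : unit_at (h p) (res iU (theta g)) by apply/unit_at_res/chart_unit.
have : unit_at (h p) (res iU (theta (a * g + b * f))).
  have -> : res iU (theta (a * g + b * f)) =
      res iV (s + t) * (res iU (theta f) * res iU (theta g)).
    rewrite !rmorphD !rmorphM -e -e' mulrDl mulrA; congr (_ + _).
    by rewrite [in RHS](mulrC (res iU (theta f))) mulrA.
  by apply/unit_atM; split; [exact/unit_at_res | exact/unit_atM].
move/unit_at_res => /(_ Ip)/chart_unit pn.
case: (pselect (prime_set p a)) => pa.
  right; apply/(unit_at_res iV) => //.
  suff : unit_at (h p) (res iU (theta b)) by rewrite -e' => /unit_atM[].
  apply/unit_at_res/chart_unit => // pb; apply: pn.
  by apply: primeD; rewrite mulrC; exact: primeMl.
left; apply/(unit_at_res iV) => //.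
suff : unit_at (h p) (res iU (theta a)) by rewrite -e => /unit_atM[].
exact/unit_at_res/chart_unit.
Qed.

Lemma chart_unit_at0 p (V : opens X) : ~ unit_at (h p) (0 : sect X V).
Proof.
move=> u0; have Vp := unit_at_in u0.
have iU : openI_ V U `<=` U by move=> x [].
have iV : openI_ V U `<=` V by move=> x [].
have Ip : oset (openI_ V U) (h p) by split=> //; exact: chart_in.
move/(unit_at_res iV): u0 => /(_ Ip).
rewrite rmorph0 -(rmorph0 (res iU)) -(rmorph0 theta).
by move/(unit_at_res iU) => /(_ Ip)/chart_unit; apply; exact: prime0.
Qed.

Lemma chart_unit_locus r : (unit_locus (theta r) : set X) = h @` basic_open r.
Proof.
apply/seteqP; split=> x /=.
  move=> ux; have [p px] := chart_onto (unit_at_in ux).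
  by exists p => //; apply/chart_unit; rewrite px.
by case=> p pr <-; apply/chart_unit.
Qed.

End Chart.

Section LocalRing.
Variable X : scheme.
Implicit Types (x : X) (U V W : opens X).

Lemma unit_atD x U (s t : sect X U) :
  unit_at x (s + t) -> unit_at x s \/ unit_at x t.
Proof.
have [A [[R [h [theta c]]] Ax]] := scheme_affine x.
by have [p <-] := chart_onto c Ax; exact: (chart_unit_atD c).
Qed.

Lemma unit_at0 x U : ~ unit_at x (0 : sect X U).
Proof.
have [A [[R [h [theta c]]] Ax]] := scheme_affine x.
by have [p <-] := chart_onto c Ax; exact: (chart_unit_at0 c).
Qed.

(** The sections whose germ at x lies in the maximal ideal of the stalk. *)
Definition point_ideal U x (Ux : oset U x) : primeSpec (sect X U).
Proof.
refine (@PrimeIdeal (sect X U) [set s | ~ unit_at x s] _ _ _ _ _) => /=.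
- exact: unit_at0.
- by move=> a b na nb /unit_atD[].
- by move=> a b nb /unit_atM[].
- by apply; exact: unit_at1.
move=> a b nab; apply: contrapT => /not_orP[/contrapT ua /contrapT ub].
by apply: nab; apply/unit_atM.
Defined.

End LocalRing.

Section Affine.
Variables (X : scheme) (U : opens X).
Implicit Types V W : opens X.
Hypothesis aU : affine U.

(** Distinct prime ideals differ in some section, so the sections invertible at
    a point of an affine open set determine the point. *)
Lemma affine_point_eq (x y : X) : oset U x -> oset U y ->
  (forall s : sect X U, unit_at x s <-> unit_at y s) -> x = y.
Proof.
have [R [h [theta c]]] := aU.
move=> /(chart_onto c)[p <-] /(chart_onto c)[q <-] pq.
congr h; apply: primeSpec_eq => r.
have := pq (theta r); rewrite !(chart_unit c) => e.
by split=> H; apply: contrapT => /e.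
Qed.

Lemma affine_point (P : primeSpec (sect X U)) :
  exists2 x, oset U x & forall s : sect X U, unit_at x s <-> ~ prime_set P s.
Proof.
have [R [h [theta c]]] := aU.
pose p := prime_comap theta P.
exists (h p); first exact: (chart_in c).
by move=> s; have [r <-] := chart_sect_onto c s; rewrite (chart_unit c).
Qed.

Lemma affine_base x V : oset U x -> oset V x ->
  exists2 g : sect X U, unit_at x g & unit_locus g `<=` V.
Proof.
have [R [h [theta c]]] := aU.
move=> /(chart_onto c)[p <-] /(chart_base c)[f pf fV].
exists (theta f); first exact/(chart_unit c).
by rewrite (chart_unit_locus c).
Qed.

Lemma affine_frac x V (s : sect X V) : oset U x -> oset V x ->
  exists (g a : sect X U) (k : unit_locus g `<=` V) (l : unit_locus g `<=` U),
    unit_at x g /\ res k s * res l g = res l a.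
Proof.
have [R [h [theta c]]] := aU.
move=> /(chart_onto c)[p <-] /(chart_frac c s)[f [a [W [k [l [pf eW e]]]]]].
have gW : unit_locus (theta f) `<=` W by rewrite (chart_unit_locus c) eW.
exists (theta f), (theta a), (subset_trans gW k), (subset_trans gW l).
by rewrite -!res_res -rmorphM e; split=> //; exact/(chart_unit c).
Qed.

(** A section that vanishes on D(g) is killed by a power of g. *)
Lemma affine_zero x V (l : V `<=` U) (a : sect X U) : oset V x ->
  res l a = 0 -> exists2 g, unit_at x g & g * a = 0.
Proof.
have [R [h [theta c]]] := aU.
have [r <-] := chart_sect_onto c a.
move=> Vx; have [p px] := chart_onto c (l _ Vx); subst x.
move=> /(chart_zero c Vx)[g pg g0].
by exists (theta g); [exact/(chart_unit c) | rewrite -rmorphM g0 rmorph0].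
Qed.

Lemma affine_zero_eq x V (l : V `<=` U) (a b : sect X U) : oset V x ->
  res l a = res l b -> exists2 g, unit_at x g & g * a = g * b.
Proof.
move=> Vx ab; have [||g ug gab] := @affine_zero x V l (a - b) => //.
  by rewrite rmorphB ab subrr.
by exists g => //; apply/eqP; rewrite -subr_eq0 -mulrBr gab.
Qed.

End Affine.

Section AffineBasis.
Variable X : scheme.
Implicit Types U V W : opens X.

(** D(f) in an affine open set is affine, with the ring of its own sections as
    coordinate ring: this ring is a localization at f, so its primes are the
    primes p without f, and localizing it at g, where g f^n comes from r, is
    localizing the original ring at r f. *)
Lemma affine_unit_locus U (g : sect X U) : affine U -> affine (unit_locus g).
Proof.
move=> aU; have [R [h [theta c]]] := aU.
have [f fg] := chart_sect_onto c g; subst g.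
set V := unit_locus (theta f).
have VU : V `<=` U by exact: unit_locus_sub.
have eV : (V : set X) = h @` basic_open f by exact: (chart_unit_locus c).
pose rho : {rmorphism R -> sect X V} := res VU \o theta.
have [[fi fiE] frac ker] : is_localization f rho by exact: (chart_loc c).
have rhoE x r : oset V x -> unit_at x (rho r) <-> unit_at x (theta r).
  by move=> Vx; exact: unit_at_res.
have fu x : oset V x -> unit_at x (rho f) by move=> Vx; exact/rhoE.
(* A prime P of the sections over V gives the point of U whose prime is the
   preimage of P under rho; it lies in V because rho f is a unit. *)
have pt (P : primeSpec (sect X V)) : exists x, oset V x /\
    forall s : sect X V, unit_at x s <-> ~ prime_set P s.
  have Pf n : ~ prime_set P (rho f ^+ n).
    move/primeX => Pf; apply: (@prime1 _ P).
    by rewrite -fiE mulrC; exact: primeMl.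
  pose p := prime_comap rho P.
  have Vp : oset V (h p) by rewrite eV; exists p => //; exact: (Pf 1).
  exists (h p); split=> // s; have [n [r e]] := frac s.
  have -> : unit_at (h p) s <-> unit_at (h p) (rho r).
    by rewrite -e; split=> [us|/unit_atM[]//]; apply/unit_atM; split=> //;
      exact/unit_atX/fu.
  have -> : unit_at (h p) (rho r) <-> ~ prime_set P (s * rho f ^+ n).
    by rewrite rhoE // (chart_unit c) e.
  rewrite prime_mulE.
  split=> [n1 Ps|nPs [//|]]; first by apply: n1; left.
  exact: Pf.
have [h' h'V h'u] : exists2 h' : primeSpec (sect X V) -> X,
    (forall P, oset V (h' P))
    & forall P s, unit_at (h' P) s <-> ~ prime_set P s.
  have [h' h'P] := choice pt.
  by exists h' => P; case: (h'P P).
have h'I : injective h'.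
  move=> P Q PQ; apply: primeSpec_eq => s.
  have := h'u P s; rewrite PQ h'u => e.
  by split=> H; apply: contrapT => /e.
have h'K x (Vx : oset V x) : h' (point_ideal Vx) = x.
  apply: (affine_point_eq aU) => [||r]; [exact: (VU _ (h'V _)) | exact: (VU _ Vx) |].
  rewrite -(unit_at_res VU); last exact: h'V.
  rewrite h'u /= -(unit_at_res VU) //.
  by split=> [/contrapT//|ux]; exact.
exists (sect X V), h', idfun; split=> //.
- apply/seteqP; split=> [_ [P _ <-]|x Vx]; first exact: h'V.
  by exists (point_ideal Vx).
- move=> W; split.
    case=> S ->.
    rewrite (_ : image _ _ = \bigcup_(s in S) unit_locus s).
      by apply: bigcup_open => s _; exact: oset_open.
    apply/seteqP; split=> x.
      by move=> [P [s Ss Ps] <-]; exists s => //; exact/h'u.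
    move=> [s Ss us]; have Vx := unit_at_in us.
    exists (point_ideal Vx) => //; exists s => //=; exact.
  move=> oW; pose O : opens X := Opens oW.
  have [hI _ ho _] := c.
  have : open (h @^-1` O).
    apply/ho; rewrite [X in open X](_ : _ = oset O) //.
    apply/seteqP; split=> x; first by move=> [p Op <-].
    move=> Ox; have [|p px] := @chart_onto _ _ _ _ _ c x.
      by case: Ox => P _ <-; exact: (VU _ (h'V P)).
    by exists p => //=; rewrite px.
  move=> [S eS]; exists [set rho r | r in S].
  apply/seteqP; split=> P /=.
    move=> WP; have [p px] := chart_onto c (VU _ (h'V P)).
    have : (h @^-1` O) p by rewrite /= px; exists P.
    rewrite eS => -[r Sr pr]; exists (rho r); first by exists r.
    by apply/h'u/rhoE; [exact: h'V | rewrite -px; exact/(chart_unit c)].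
  move=> [_ [r Sr <-] Pr].
  have [p px] := chart_onto c (VU _ (h'V P)).
  have : (h @^-1` O) p.
    rewrite eS; exists r => //; apply/(chart_unit c); rewrite px.
    by apply/rhoE; [exact: h'V | exact/h'u].
  by rewrite /= px => -[Q WQ /h'I <-].
move=> g V2 k eV2.
have [n [r e]] := frac g.
have V2u x : oset V2 x <-> unit_at x g.
  rewrite eV2; split=> [[P Pg <-]|ug]; first exact/h'u.
  by exists (point_ideal (unit_at_in ug)) => //=; exact.
have eV2' : (V2 : set X) = h @` basic_open (r * f).
  rewrite -(chart_unit_locus c); apply/seteqP; split=> x.
    move=> /[dup] /k Vx /V2u ug; rewrite rmorphM; apply/unit_atM; split=> //.
    by apply/rhoE => //; rewrite -e; apply/unit_atM; split=> //; exact/unit_atX/fu.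
  rewrite /= rmorphM => /unit_atM[ur uf]; apply/V2u.
  have Vx : oset V x by [].
  by move/rhoE: ur => /(_ Vx); rewrite -e => /unit_atM[].
(* g and rho (r f) differ by a power of the unit rho f, so D(g) = D(r f). *)
have rE : rho (r * f) = g * rho f ^+ n.+1 by rewrite rmorphM -e exprSr mulrA.
have fiX m : rho f ^+ m * fi ^+ m = 1 by rewrite -exprMn fiE expr1n.
have l2 : V2 `<=` U by move=> x /k/VU.
have l2E s : res k (rho s) = res l2 (theta s) by exact: res_comp.
have [_ frac2 ker2] := chart_loc c l2 eV2'.
split.
- apply: unit_atP => x V2x; apply/unit_at_res => //.
  exact/V2u.
- move=> b; have [m [a ea]] := frac2 b; rewrite /= -!l2E rE in ea.
  exists m, (rho a * fi ^+ (n.+1 * m)) => /=.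
  rewrite rmorphM -ea -mulrA -!rmorphXn -rmorphM; congr (b * res k _).
  by rewrite rmorphXn exprMn -exprM -mulrA fiX mulr1.
move=> s /= s0; have [m [a ea]] := frac s.
have [|m' e'] := ker2 a; first by rewrite /= -l2E -ea rmorphM s0 mul0r.
exists m'.
have : rho ((r * f) ^+ m' * a) * (fi ^+ (n.+1 * m') * fi ^+ m) = 0.
  by rewrite e' rmorph0 mul0r.
rewrite rmorphM rmorphXn rE -ea mulrACA -[s * _ * _]mulrA fiX mulr1.
by rewrite exprMn -exprM -[g ^+ _ * _ * _]mulrA fiX mulr1.
Qed.

(** The sets D(g) inside affine open sets are affine and form a base. *)
Lemma affine_nbhs x W : oset W x ->
  exists V, [/\ affine V, V `<=` W & oset V x].
Proof.
move=> Wx; have [A [aA Ax]] := scheme_affine x.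
have [g ug gW] := affine_base aA Ax Wx.
by exists (unit_locus g); split=> //; exact: affine_unit_locus.
Qed.

End AffineBasis.

(** * Fractions and equality of morphisms *)

Section Fractions.
Variable X : ringedSpace.
Implicit Types O U V W : opens X.

(** The equation t = c / f on W, written without a division: it then makes
    sense for all f and is preserved by restrictions and ring homomorphisms. *)
Definition is_frac O V (t : sect X V) W (f c : sect X O) : Prop :=
  exists (hV : W `<=` V) (hO : W `<=` O), res hV t * res hO f = res hO c.

Lemma is_frac_sub O V (t : sect X V) W W' (f c : sect X O) :
  W' `<=` W -> is_frac t W f c -> is_frac t W' f c.
Proof.
move=> l [h [k e]]; exists (subset_trans l h), (subset_trans l k).
by rewrite -!res_res -rmorphM e.
Qed.

Lemma is_frac_resl O V V' (h : V' `<=` V) (t : sect X V) W (f c : sect X O) :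
  W `<=` V' -> is_frac (res h t) W f c <-> is_frac t W f c.
Proof.
move=> l; split=> -[k [k' e]].
  by exists (subset_trans k h), k'; rewrite -res_res.
exists l, k'; rewrite res_res -e; congr (_ * _); exact: eq_res.
Qed.

Lemma is_frac_resr O O' V (h : O' `<=` O) (t : sect X V) W (f c : sect X O) :
  W `<=` O' -> is_frac t W (res h f) (res h c) <-> is_frac t W f c.
Proof.
move=> l; split=> -[k [k' e]].
  by exists k, (subset_trans k' h); rewrite -!res_res.
exists k, l; rewrite !res_res (eq_res _ k' f) e; exact: eq_res.
Qed.

Lemma is_fracD O V (t t' : sect X V) W (f c f' c' : sect X O) :
  is_frac t W f c -> is_frac t' W f' c' ->
  is_frac (t + t') W (f * f') (c * f' + c' * f).
Proof.
move=> [h [k e]] [h' [k' e']]; exists h, k.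
rewrite (eq_res _ h) !(eq_res k' k) in e'.
rewrite !rmorphD !rmorphM -e -e' mulrDl mulrA; congr (_ + _).
by rewrite mulrA mulrAC.
Qed.

Lemma is_fracM O V (t t' : sect X V) W (f c f' c' : sect X O) :
  is_frac t W f c -> is_frac t' W f' c' ->
  is_frac (t * t') W (f * f') (c * c').
Proof.
move=> [h [k e]] [h' [k' e']]; exists h, k.
rewrite (eq_res _ h) !(eq_res k' k) in e'.
by rewrite !rmorphM -e -e' mulrACA.
Qed.

Lemma is_frac_eq O V (t t' : sect X V) W (f c : sect X O) (h : W `<=` V) :
  (forall x, oset W x -> unit_at x f) ->
  is_frac t W f c -> is_frac t' W f c -> res h t = res h t'.
Proof.
move=> uf [h1 [k e]] [h2 [k' e']].
apply: (unit_at_cancel_local (f := res k f)).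
  by move=> x Wx; apply/unit_at_res => //; exact: uf.
by rewrite (eq_res _ h1) e (eq_res _ h2) !(eq_res k k') e'.
Qed.

Lemma is_frac_cross O V (t : sect X V) W (f c f' c' : sect X O) (k : W `<=` O) :
  is_frac t W f c -> is_frac t W f' c' -> res k (f * c') = res k (f' * c).
Proof.
move=> [h1 [k1 e1]] [h2 [k2 e2]].
rewrite !rmorphM (eq_res k k1 c) -e1 (eq_res k k2 c') -e2.
rewrite !(eq_res _ k) (eq_res h2 h1) mulrCA [RHS]mulrCA; congr (_ * _).
exact: mulrC.
Qed.

End Fractions.

Section MorPull.
Variables (X Y : ringedSpace) (f : mor X Y).
Implicit Types (U : opens X) (V : opens Y).

Lemma mor_pull_res U V V' (k : V' `<=` V) (h' : U `<=` mor_pre f V')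
    (h : U `<=` mor_pre f V) (s : sect Y V) :
  mor_pull h' (res k s) = mor_pull h s.
Proof.
have l : mor_pre f V' `<=` mor_pre f V by move=> x; exact: k.
by rewrite /mor_pull /= -(mor_res k l) res_res; exact: eq_res.
Qed.

Lemma res_mor_pull U U' V (k : U' `<=` U) (h : U `<=` mor_pre f V)
    (h' : U' `<=` mor_pre f V) (s : sect Y V) :
  res k (mor_pull h s) = mor_pull h' s.
Proof. by rewrite /mor_pull /= res_res; exact: eq_res. Qed.

Lemma unit_at_mor_pull U V (h : U `<=` mor_pre f V) (s : sect Y V) x :
  oset U x -> unit_at x (mor_pull h s) <-> unit_at (f x) s.
Proof.
move=> Ux; have Vx : oset (mor_pre f V) x by exact: h.
rewrite /mor_pull /= unit_at_res //; split; first exact: mor_local.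
case=> W [k [Wx [u e]]].
have l : mor_pre f W `<=` mor_pre f V by move=> y; exact: k.
exists (mor_pre f W), l; split=> //; exists (mor_sh f W u).
by rewrite (mor_res k) -rmorphM e rmorph1.
Qed.

Lemma is_frac_mor_pull O V (t : sect Y V) W (g c : sect Y O) U
    (N N' : opens X)
    (h : N `<=` mor_pre f V) (k : N' `<=` mor_pre f O) :
  U `<=` mor_pre f W -> U `<=` N -> U `<=` N' ->
  is_frac t W g c ->
  is_frac (mor_pull h t) U (mor_pull k g) (mor_pull k c).
Proof.
move=> UW UN UN' [hV [hO e]]; exists UN, UN'.
have Uh := subset_trans UN h; have Uk := subset_trans UN' k.
rewrite (res_mor_pull UN h Uh) !(res_mor_pull UN' k Uk).
rewrite -(mor_pull_res hV UW Uh) -!(mor_pull_res hO UW Uk).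
by rewrite -rmorphM e.
Qed.

End MorPull.

(** The points of an affine open subset of the target are told apart by the
    sections that are invertible at them, and sections over other open sets are
    locally fractions of sections over the affine one. *)
Lemma mor_eq_local (Z Y : scheme) (f g : mor Z Y) :
  (forall z, exists (O : opens Y) (N : opens Z) (h : N `<=` mor_pre f O)
       (k : N `<=` mor_pre g O),
     [/\ affine O, oset N z & forall s, mor_pull h s = mor_pull k s]) ->
  mor_eq f g.
Proof.
move=> fg.
have fgE z : f z = g z.
  have [O [N [h [k [aO Nz e]]]]] := fg z.
  apply: (affine_point_eq aO (h _ Nz) (k _ Nz)) => s.
  by rewrite -(unit_at_mor_pull h) // e unit_at_mor_pull.
split=> // V U h k s; apply: sect_eq_local => z Uz.
have [O [N [h' [k' [aO Nz e]]]]] := fg z.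
have [a [c [hV [hO [ua es]]]]] := affine_frac aO s (h' _ Nz) (h _ Uz).
have fr : is_frac s (unit_locus a) a c by exists hV, hO.
pose U' := openI_ (openI_ U N) (mor_pre f (unit_locus a)).
have U'U : U' `<=` U by move=> x [[]].
have U'N : U' `<=` N by move=> x [[]].
exists U', U'U; split=> //.
apply: (is_frac_eq (O := N) (f := mor_pull h' a) (c := mor_pull h' c)).
- move=> x U'x; apply/unit_at_mor_pull; first exact: U'N.
  by case: U'x.
- by apply: is_frac_mor_pull fr => // x [].
- rewrite !e; apply: is_frac_mor_pull fr => // x [_].
  by rewrite /= fgE.
Qed.

(** * Gluing morphisms *)

Section Gluing.
Variables (Z Y : scheme) (J : Type) (O : J -> opens Y) (N : J -> opens Z).
Variable phi : forall j, {rmorphism sect Y (O j) -> sect Z (N j)}.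
Hypothesis aO : forall j, affine (O j).
Hypothesis Ncover : forall z, exists j, oset (N j) z.
Hypothesis phi_compat : forall j k z, oset (N j) z -> oset (N k) z ->
  exists l (hj : O l `<=` O j) (hk : O l `<=` O k)
         (nj : N l `<=` N j) (nk : N l `<=` N k),
    [/\ oset (N l) z,
        forall s, res nj (phi j s) = phi l (res hj s)
      & forall s, res nk (phi k s) = phi l (res hk s)].

Implicit Types (V : opens Y) (M : opens Z).

(** The prime ideal at the image of z is the preimage under phi j of the ideal
    at z. Two choices of j give the same point by comparison with a smaller
    index l. *)
Lemma glue_points : exists i : Z -> Y, forall j z, oset (N j) z ->
  oset (O j) (i z) /\
  forall s : sect Y (O j), unit_at (i z) s <-> unit_at z (phi j s).
Proof.
have pt j z : oset (N j) z -> exists y, oset (O j) y /\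
    forall s : sect Y (O j), unit_at y s <-> unit_at z (phi j s).
  move=> Nz.
  have [y Oy yP] := affine_point (aO j) (prime_comap (phi j) (point_ideal Nz)).
  exists y; split=> // s; rewrite yP /=.
  by split=> [/contrapT//|u]; exact.
have [|i iP] := @choice Z Y (fun z y => forall j, oset (N j) z ->
  oset (O j) y /\
  forall s : sect Y (O j), unit_at y s <-> unit_at z (phi j s)); last first.
  by exists i => j z; exact: iP.
move=> z.
have [j Njz] := Ncover z; have [y [Oy yP]] := pt j z Njz.
exists y => k Nkz.
have [y' [Oy' yP']] := pt k z Nkz.
suff <- : y' = y by [].
have [l [hj [hk [nj [nk [Nlz ej ek]]]]]] := phi_compat Njz Nkz.
have [y2 [Oy2 yP2]] := pt l z Nlz.
transitivity y2.
  apply: (affine_point_eq (aO k)) => [//||s]; first exact: (hk _ Oy2).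
  by rewrite yP' -(unit_at_res hk s Oy2) yP2 -ek unit_at_res.
apply: (affine_point_eq (aO j)) => [|//|s]; first exact: (hj _ Oy2).
by rewrite yP -(unit_at_res hj s Oy2) yP2 -ej unit_at_res.
Qed.

Variable i : Z -> Y.
Hypothesis iO : forall j z, oset (N j) z -> oset (O j) (i z).
Hypothesis iu : forall j z (s : sect Y (O j)), oset (N j) z ->
  unit_at (i z) s <-> unit_at z (phi j s).

Lemma glue_cont : continuous i.
Proof.
apply/continuousP => V oV; pose VO : opens Y := Opens oV.
rewrite (_ : _ @^-1` _ = \bigcup_(W in [set W : opens Z |
    (W : set Z) `<=` i @^-1` V]) W).
  by apply: bigcup_open => W _; exact: oset_open.
apply/seteqP; split=> z /=; last by case=> W WV /WV.
move=> Vz; have [j Nz] := Ncover z.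
have [g ug gV] := affine_base (aO j) (iO Nz) (Vz : oset VO (i z)).
exists (unit_locus (phi j g)); last exact/iu.
by move=> w uw; apply: gV; apply/(iu _ (unit_at_in uw)).
Qed.

Let pre (V : opens Y) : opens Z := Opens (preimage_open glue_cont V).

(** This is what makes pullbacks of fractions well defined: sections that agree
    near a point become equal when multiplied by some g that is invertible at
    the point, and the image of g is invertible as well. *)
Lemma phi_eq_local j (W : opens Y) (l : W `<=` O j) (a b : sect Y (O j))
    (W' : opens Z) (n : W' `<=` N j) :
  W' `<=` pre W -> res l a = res l b -> res n (phi j a) = res n (phi j b).
Proof.
move=> W'W ab; apply: sect_eq_local => z W'z.
have [g ug gab] := affine_zero_eq (aO j) (W'W _ W'z) ab.
pose D := openI_ W' (unit_locus (phi j g)).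
have DW' : D `<=` W' by move=> x [].
exists D, DW'; split; first by split=> //; exact/(iu _ (n _ W'z)).
have DN : D `<=` N j by move=> x /DW'/n.
rewrite !(res_comp n DW' DN).
apply: (unit_at_cancel_local (f := res DN (phi j g))).
  by move=> x Dx; apply/unit_at_res => //; case: Dx.
by rewrite -!rmorphM ![_ * g]mulrC gab.
Qed.

(** The relation between a section and its pullback. It quantifies over all
    fractions at once, so that it restricts without any choice; by
    [pulls_local], one fraction near each point is enough to establish it. *)
Definition pulls V (t : sect Y V) N' (s : sect Z N') : Prop :=
  forall j (W : opens Y) (f c : sect Y (O j)) (W' : opens Z),
    is_frac t W f c -> W' `<=` N j -> W' `<=` N' -> W' `<=` pre W ->
    is_frac s W' (phi j f) (phi j c).

Lemma fraction_at V (t : sect Y V) j z : oset (N j) z -> oset (pre V) z ->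
  exists f c, [/\ unit_at z (phi j f), is_frac t (unit_locus f) f c
    & unit_locus (phi j f) `<=` pre (unit_locus f)].
Proof.
move=> Nz Vz; have [f [c [h [k [uf e]]]]] := affine_frac (aO j) t (iO Nz) Vz.
exists f, c; split; [exact/iu | by exists h, k |].
by move=> x ux; apply/(iu _ (unit_at_in ux)).
Qed.

(** Two fractions c / f and c1 / f1 for t satisfy f c1 = f1 c, hence so do their
    images near each point by [phi_eq_local]. As the image of f is invertible,
    s f1 = c1 follows from s f = c. *)
Lemma pulls_local V (t : sect Y V) N' (s : sect Z N') :
  (forall z, oset N' z -> exists j (W : opens Y) (f c : sect Y (O j)) W',
     [/\ oset W' z, W' `<=` pre W, unit_at z (phi j f), is_frac t W f c
       & is_frac s W' (phi j f) (phi j c)]) ->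
  pulls t s.
Proof.
move=> loc k W1 f1 c1 W1' fr1 W1'N W1'N' W1'W.
exists W1'N', W1'N; apply: sect_eq_local => z W1'z.
have [j [W [f [c [W' [W'z W'W uf fr fr']]]]]] := loc z (W1'N' _ W1'z).
have [W'N' [W'N _]] := fr'.
have [l [hj [hk [nj [nk [Nlz ej ek]]]]]] := phi_compat (W'N _ W'z) (W1'N _ W1'z).
pose D := openI_ (openI_ W1' (openI_ W' (N l))) (unit_locus (phi j f)).
have DW1' : D `<=` W1' by move=> x [[]].
have DW' : D `<=` W' by move=> x [[_ []]].
have DN : D `<=` N l by move=> x [[_ []]].
have Df : D `<=` unit_locus (phi j f) by move=> x [].
have DNk : D `<=` N k by move=> x /DN/nk.
have DN' : D `<=` N' by move=> x /DW'/W'N'.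
pose E := openI_ (openI_ W1 W) (O l).
have EO : E `<=` O l by move=> x [].
exists D, DW1'; split=> //.
have cross : res DN (phi l (res hj f * res hk c1)) =
             res DN (phi l (res hk f1 * res hj c)).
  apply: (phi_eq_local (W := E) (l := EO)) => [x Dx|].
    split; first by split; [exact/W1'W/DW1' | exact/W'W/DW'].
    exact/iO/DN.
  apply: (is_frac_cross (t := t)).
    by apply/is_frac_resr => //; apply: is_frac_sub fr => x [[]].
  by apply/is_frac_resr => //; apply: is_frac_sub fr1 => x [[]].
have DNj : D `<=` N j by move=> x /DN/nj.
have {fr'}[h1 [h2 e]] := is_frac_sub DW' fr'.
rewrite !rmorphM -!ej -!ek in cross.
rewrite !(res_comp nj DN DNj) !(res_comp nk DN DNk) in cross.
rewrite rmorphM (res_comp W1'N' DW1' DN') !(res_comp W1'N DW1' DNk).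
apply: (unit_at_cancel_local (f := res DNj (phi j f))).
  by move=> x Dx; apply/unit_at_res => //; exact: Df.
rewrite mulrAC (eq_res _ h1) (eq_res _ h2) e !(eq_res h2 DNj).
by rewrite mulrC -cross mulrC.
Qed.

Lemma pulls_uniq V (t : sect Y V) N' (s s' : sect Z N') :
  N' `<=` pre V -> pulls t s -> pulls t s' -> s = s'.
Proof.
move=> N'V ps ps'; apply: sect_eq_local => z N'z.
have [j Nz] := Ncover z.
have [f [c [uf fr sub]]] := fraction_at t Nz (N'V _ N'z).
pose D := openI_ N' (unit_locus (phi j f)).
have DN' : D `<=` N' by move=> x [].
have DN : D `<=` N j by move=> x [_ /unit_at_in].
have DW : D `<=` pre (unit_locus f) by move=> x [_ /sub].
exists D, DN'; split=> //.
apply: (is_frac_eq (O := N j) (f := phi j f) (c := phi j c)).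
- by move=> x [].
- exact: ps fr _ _ _.
- exact: ps' fr _ _ _.
Qed.

Lemma pulls_res V V' (h : V' `<=` V) (t : sect Y V) (N' N'' : opens Z) (n : N'' `<=` N')
    (s : sect Z N') :
  pulls t s -> N'' `<=` pre V' -> pulls (res h t) (res n s).
Proof.
move=> ps N''V'; apply: pulls_local => z N''z.
have [j Nz] := Ncover z.
have [f [c [uf fr sub]]] := fraction_at (res h t) Nz (N''V' _ N''z).
have fr2 : is_frac t (unit_locus f) f c.
  by have [k _] := fr; apply/(is_frac_resl h t f c k).
pose D := openI_ N'' (unit_locus (phi j f)).
have DN'' : D `<=` N'' by move=> x [].
have DN : D `<=` N j by move=> x [_ /unit_at_in].
have DW : D `<=` pre (unit_locus f) by move=> x [_ /sub].
exists j, (unit_locus f), f, c, D; split=> //.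
apply/(is_frac_resl n s _ _ DN'').
by apply: ps fr2 _ _ _ => // x /DN''/n.
Qed.

Lemma pulls_sheaf V (t : sect Y V) N' (s : sect Z N') :
  N' `<=` pre V ->
  (forall z, oset N' z -> exists (W' : opens Z) (h : W' `<=` N'),
     oset W' z /\ pulls t (res h s)) ->
  pulls t s.
Proof.
move=> N'V loc; apply: pulls_local => z N'z.
have [j Nz] := Ncover z.
have [f [c [uf fr sub]]] := fraction_at t Nz (N'V _ N'z).
have [W' [h [W'z ps]]] := loc z N'z.
pose D := openI_ W' (unit_locus (phi j f)).
have DW' : D `<=` W' by move=> x [].
have DN : D `<=` N j by move=> x [_ /unit_at_in].
have DW : D `<=` pre (unit_locus f) by move=> x [_ /sub].
exists j, (unit_locus f), f, c, D; split=> //.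
by apply/(is_frac_resl h s _ _ DW'); exact: ps fr _ _ _.
Qed.

Lemma pulls_ex_local V (t : sect Y V) z : oset (pre V) z ->
  exists M, [/\ M `<=` pre V, oset M z & exists s : sect Z M, pulls t s].
Proof.
move=> Vz; have [j Nz] := Ncover z.
have [f [c [uf fr sub]]] := fraction_at t Nz Vz.
pose D := unit_locus (phi j f).
have DN : D `<=` N j by exact: unit_locus_sub.
have [u fu] : exists u, res DN (phi j f) * u = 1.
  by apply: unit_atP => x Dx; apply/unit_at_res.
exists D; split=> //.
  by move=> x /sub Wx; case: fr => h _; exact: h.
exists (res DN (phi j c) * u).
apply: pulls_local => x Dx; exists j, (unit_locus f), f, c, D; split=> //.
exists (@subset_refl _ D), DN.
by rewrite res_id -mulrA [u * _]mulrC fu mulr1.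
Qed.

Lemma pulls_ex V (t : sect Y V) : exists s : sect Z (pre V), pulls t s.
Proof.
pose Q M (s : sect Z M) := M `<=` pre V /\ pulls t s.
have [|||s sP] := @sect_glue_local Z (pre V) Q.
- move=> M M' h s [MV ps].
  have M'V : M' `<=` pre V by exact: subset_trans MV.
  split=> //; rewrite -[t](res_id (@subset_refl _ V)).
  exact: pulls_res.
- by move=> M s s' MV [_ ps] [_ ps']; exact: pulls_uniq ps ps'.
- move=> z /(pulls_ex_local t)[M [MV Mz [s ps]]].
  by exists M; split=> //; exists s.
exists s; apply: pulls_sheaf => // z /(pulls_ex_local t)[M [MV Mz [s' ps']]].
by exists M, MV; split=> //; rewrite (sP _ _ s').
Qed.

Lemma common_fraction V (t t' : sect Y V) (s s' : sect Z (pre V)) z :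
  pulls t s -> pulls t' s' -> oset (pre V) z ->
  exists j W (f c f' c' : sect Y (O j)) M,
    [/\ oset M z, M `<=` pre W & unit_at z (phi j (f * f'))] /\
    [/\ is_frac t W f c, is_frac t' W f' c',
        is_frac s M (phi j f) (phi j c) & is_frac s' M (phi j f') (phi j c')].
Proof.
move=> ps ps' Vz; have [j Nz] := Ncover z.
have [f [c [uf fr sub]]] := fraction_at t Nz Vz.
have [f' [c' [uf' fr' sub']]] := fraction_at t' Nz Vz.
pose W := openI_ (unit_locus f) (unit_locus f').
pose D := openI_ (unit_locus (phi j f)) (unit_locus (phi j f')).
have DN : D `<=` N j by move=> x [/unit_at_in].
have DW : D `<=` pre W by move=> x [/sub ? /sub'].
have {}fr : is_frac t W f c by apply: is_frac_sub fr => x [].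
have {}fr' : is_frac t' W f' c' by apply: is_frac_sub fr' => x [].
have DV : D `<=` pre V by move=> x /DW Wx; case: fr => h _; exact: h.
exists j, W, f, c, f', c', D; split; split=> //.
- by rewrite rmorphM; apply/unit_atM.
- exact: ps fr _ _ _.
exact: ps' fr' _ _ _.
Qed.

Lemma pullsD V (t t' : sect Y V) (s s' : sect Z (pre V)) :
  pulls t s -> pulls t' s' -> pulls (t + t') (s + s').
Proof.
move=> ps ps'; apply: pulls_local => z Vz.
have [j [W [f [c [f' [c' [M [[Mz MW u] [fr fr' gr gr']]]]]]]]] :=
  common_fraction ps ps' Vz.
exists j, W, (f * f'), (c * f' + c' * f), M; split=> //; first exact: is_fracD.
by rewrite rmorphD !rmorphM; exact: is_fracD.
Qed.

Lemma pullsM V (t t' : sect Y V) (s s' : sect Z (pre V)) :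
  pulls t s -> pulls t' s' -> pulls (t * t') (s * s').
Proof.
move=> ps ps'; apply: pulls_local => z Vz.
have [j [W [f [c [f' [c' [M [[Mz MW u] [fr fr' gr gr']]]]]]]]] :=
  common_fraction ps ps' Vz.
exists j, W, (f * f'), (c * c'), M; split=> //; first exact: is_fracM.
by rewrite !rmorphM; exact: is_fracM.
Qed.

Lemma pulls_phi j V (h : V `<=` O j) (a : sect Y (O j)) M (n : M `<=` N j) :
  M `<=` pre V -> pulls (res h a) (res n (phi j a)).
Proof.
move=> MV; apply: pulls_local => z Mz.
exists j, V, 1, a, M; split=> //.
- by rewrite rmorph1; apply: unit_at1; exact: n.
- by exists (@subset_refl _ V), h; rewrite res_id rmorph1 mulr1.
by exists (@subset_refl _ M), n; rewrite res_id !rmorph1 mulr1.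
Qed.

Lemma pulls1 V : pulls (1 : sect Y V) (1 : sect Z (pre V)).
Proof.
apply: pulls_local => z Vz; have [j Nz] := Ncover z.
pose W := openI_ V (O j); pose D := openI_ (pre V) (N j).
have WV : W `<=` V by move=> x [].
have WO : W `<=` O j by move=> x [].
have DV : D `<=` pre V by move=> x [].
have DN : D `<=` N j by move=> x [].
exists j, W, 1, 1, D; split=> //.
- by move=> x [Vx /iO].
- by rewrite rmorph1; exact: unit_at1.
- by exists WV, WO; rewrite !rmorph1 mulr1.
by exists DV, DN; rewrite !rmorph1 mulr1.
Qed.

Lemma glue_sections V :
  exists g : {rmorphism sect Y V -> sect Z (pre V)}, forall t, pulls t (g t).
Proof.
have [g gP] := choice (@pulls_ex V).
have gE t s : pulls t s -> g t = s by exact: pulls_uniq.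
have gD : {morph g : t t' / t + t'} by move=> t t'; exact/gE/pullsD.
have g_nmod : nmod_morphism g.
  by split=> //; apply: (addIr (g 0)); rewrite -gD !add0r.
have g_monoid : monoid_morphism g.
  by split=> [|t t']; [exact/gE/pulls1 | exact/gE/pullsM].
pose G : {rmorphism sect Y V -> sect Z (pre V)} :=
  HB.pack g (GRing.isNmodMorphism.Build _ _ _ g_nmod)
    (GRing.isMonoidMorphism.Build _ _ _ g_monoid).
by exists G.
Qed.

Lemma glue_sections_mor : exists m : mor Z Y,
  forall j, exists h : N j `<=` mor_pre m (O j), forall s, mor_pull h s = phi j s.
Proof.
have [sh shP] : {sh : forall V, {rmorphism sect Y V -> sect Z (pre V)} |
    forall V t, pulls t (sh V t)}.
  by exists (fun V => sval (cid (glue_sections V))) => V t;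
    exact: (svalP (cid (glue_sections V))).
have sh_res V V' (h : V' `<=` V) (k : pre V' `<=` pre V) s :
    res k (sh V s) = sh V' (res h s).
  by apply: pulls_uniq (shP V' _) => //; exact: pulls_res.
have sh_local V s z : oset (pre V) z -> unit_at z (sh V s) -> unit_at (i z) s.
  move=> Vz us; have [j Nz] := Ncover z.
  have [f [c [uf fr sub]]] := fraction_at s Nz Vz.
  have Wz : oset (unit_locus f) (i z) by exact: sub.
  pose D := unit_locus (phi j f).
  have DN : D `<=` N j by exact: unit_locus_sub.
  have DV : D `<=` pre V by move=> x /sub Wx; case: fr => h _; exact: h.
  have [h1 [h2 e]] := shP V s j _ f c D fr DN DV sub.
  have uc : unit_at z (phi j c).
    by apply/(unit_at_res h2) => //; rewrite -e; apply/unit_atM;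
      split; exact/unit_at_res.
  have [k1 [k2 e']] := fr; apply/(unit_at_res k1) => //.
  suff /unit_atM[] : unit_at (i z) (res k1 s * res k2 f) by [].
  by rewrite e'; apply/unit_at_res => //; exact/iu.
exists (@Mor Z Y i glue_cont sh sh_res sh_local) => j.
have Nj : N j `<=` pre (O j) by move=> z; exact: iO.
exists Nj => s; apply: (@pulls_uniq (O j) s (N j)) => //.
  rewrite -[X in pulls X](res_id (@subset_refl _ (O j))).
  exact: pulls_res.
rewrite -[X in pulls X](res_id (@subset_refl _ (O j))).
rewrite -[X in pulls _ X](res_id (@subset_refl _ (N j))).
exact: pulls_phi.
Qed.

End Gluing.

(** An affine open set O j is the spectrum of its ring of sections, so phi j
    amounts to a morphism from N j to O j; the indices l below N j and N k
    express that these morphisms agree on overlaps. *)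
Lemma mor_glue (Z Y : scheme) (J : Type) (O : J -> opens Y) (N : J -> opens Z)
    (phi : forall j, {rmorphism sect Y (O j) -> sect Z (N j)}) :
  (forall j, affine (O j)) ->
  (forall z, exists j, oset (N j) z) ->
  (forall j k z, oset (N j) z -> oset (N k) z ->
   exists l (hj : O l `<=` O j) (hk : O l `<=` O k)
          (nj : N l `<=` N j) (nk : N l `<=` N k),
     [/\ oset (N l) z,
         forall s, res nj (phi j s) = phi l (res hj s)
       & forall s, res nk (phi k s) = phi l (res hk s)]) ->
  exists m : mor Z Y, forall j, exists h : N j `<=` mor_pre m (O j),
    forall s, mor_pull h s = phi j s.
Proof.
move=> aO cov compat; have [i iP] := glue_points aO cov compat.
apply: (glue_sections_mor (i := i) aO cov compat) => j z.
  by move=> /iP[].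
by move=> s /iP[_].
Qed.

(** * Closed immersions *)

Lemma opens_eq (X : topologicalType) (U V : opens X) : (U : set X) = V -> U = V.
Proof.
by case: U V => [U oU] [V oV] /= UV; subst V; congr Opens; exact: Prop_irrelevance.
Qed.

Lemma unit_at_mor_sh (X Y : ringedSpace) (f : mor X Y) (V : opens Y)
    (s : sect Y V) x :
  oset V (f x) -> unit_at x (mor_sh f V s) <-> unit_at (f x) s.
Proof.
move=> Vx.
rewrite -(unit_at_mor_pull (@subset_refl _ (mor_pre f V))) //.
by rewrite /mor_pull /= res_id.
Qed.

Section ClosedImmersion.
Variables (Z Y : scheme) (i : mor Z Y).

(** If all sections killed by the surjection were in the prime ideal of y, then
    the image of this ideal would be a prime ideal, hence the ideal of a point
    that i sends to y. *)
Lemma affine_surj_range (O : opens Y) y :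
  affine O -> affine (mor_pre i O) ->
  (forall b, exists a, mor_sh i O a = b) -> oset O y -> ~ range i y ->
  exists a, mor_sh i O a = 0 /\ unit_at y a.
Proof.
move=> aO aN onto Oy ny; apply: contrapT => noa.
have ker a : mor_sh i O a = 0 -> ~ unit_at y a.
  by move=> a0 ua; apply: noa; exists a.
have diff a a' : mor_sh i O a = mor_sh i O a' -> unit_at y a -> unit_at y a'.
  move=> aa'; rewrite -[a in unit_at _ a](subrK a') => /unit_atD[|//].
  by move/ker; rewrite rmorphB aa' subrr.
have [P PE] : exists P : primeSpec (sect Z (mor_pre i O)),
    forall a, prime_set P (mor_sh i O a) <-> ~ unit_at y a.
  unshelve eexists (@PrimeIdeal _ [set b | exists2 a, mor_sh i O a = b &
    ~ unit_at y a] _ _ _ _ _) => /=.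
  - by exists 0; [exact: rmorph0 | exact: unit_at0].
  - move=> _ _ [a <- na] [b <- nb]; exists (a + b); first exact: rmorphD.
    by case/unit_atD.
  - move=> b _ [a <- na]; have [c <-] := onto b.
    by exists (c * a); [exact: rmorphM | case/unit_atM].
  - move=> [a a1]; apply; apply: (diff 1); last exact: unit_at1.
    by rewrite rmorph1.
  - move=> b c [a]; have [[b' <-] [c' <-]] := (onto b, onto c).
    rewrite -rmorphM => abc na.
    apply: contrapT => /not_orP[nb nc].
    apply: na; apply: (diff (b' * c')) => //; apply/unit_atM; split.
      by apply: contrapT => nu; apply: nb; exists b'.
    by apply: contrapT => nu; apply: nc; exists c'.
  move=> a; split=> [[a' aa' na'] ua|na]; last by exists a.
  by apply: na'; apply: (diff a).
have [z Oz zP] := affine_point aN P.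
apply: ny; exists z => //; apply: (affine_point_eq aO) => // a.
rewrite -unit_at_mor_sh // zP PE.
by split=> [/contrapT//|ua]; exact.
Qed.

(** On an affine piece, surjectivity lets every section upstairs be lifted:
    units at points, distinguished open sets and fractions then all come from
    the target, which gives injectivity, the subspace topology and the
    surjectivity on stalks. The range is closed by [affine_surj_range]. *)
Lemma closed_immersion_affine :
  (forall y, exists O : opens Y, [/\ oset O y, affine O, affine (mor_pre i O)
     & forall b, exists a, mor_sh i O a = b]) ->
  closed_immersion i.
Proof.
move=> loc.
have cl : closed (range i).
  rewrite -[range i]setCK; apply: open_closedC.
  pose I := [set V : opens Y | (V : set Y) `<=` ~` range i].
  rewrite (_ : ~` _ = \bigcup_(V in I) V).
    by apply: bigcup_open => V _; exact: oset_open.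
  apply/seteqP; split=> y; last by case=> V VI /VI.
  move=> ny; have [O [Oy aO aN onto]] := loc y.
  have [a [a0 ua]] := affine_surj_range aO aN onto Oy ny.
  exists (unit_locus a) => // _ /[swap] -[z _ <-] /=.
  move=> ua'; have Oz := unit_at_in ua'.
  by move/unit_at_mor_sh: ua' => /(_ Oz); rewrite a0; exact: unit_at0.
split=> //.
- move=> z z' zz'; have [O [Oz aO aN onto]] := loc (i z).
  apply: (affine_point_eq aN) => //; first by rewrite /= -zz'.
  move=> b; have [a <-] := onto b.
  by rewrite !unit_at_mor_sh ?zz' // -zz'.
- move=> W; pose I := [set V : opens Y | i @^-1` V `<=` W].
  have oI : open (\bigcup_(V in I) (V : set Y)).
    by apply: bigcup_open => V _; exact: oset_open.
  exists (Opens oI); apply/seteqP; split=> z /=; last by case=> V VI /VI.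
  move=> Wz; have [O [Oz aO aN onto]] := loc (i z).
  have [b ub bW] := affine_base aN (Oz : oset (mor_pre i O) z) Wz.
  have [a ab] := onto b; exists (unit_locus a).
    move=> w uw; apply: bW; rewrite /= -ab.
    by apply/unit_at_mor_sh => //; exact: (unit_at_in uw).
  by apply/unit_at_mor_sh => //; rewrite ab.
move=> V s y Vy.
case: (pselect (range i y)) => [[z _ zy]|ny].
  subst y; have [O [Oz aO aN onto]] := loc (i z).
  have [g [c [h [l [ug e]]]]] :=
    affine_frac aN s (Oz : oset (mor_pre i O) z) Vy.
  have [g' gg'] := onto g; have [c' cc'] := onto c; subst g c.
  pose V' := openI_ V (unit_locus g').
  have V'V : V' `<=` V by move=> x [].
  have V'O : V' `<=` O by move=> x [_ /unit_at_in].
  have [u gu] : exists u, res V'O g' * u = 1.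
    by apply: unit_atP => x V'x; apply/unit_at_res => //; case: V'x.
  have k : mor_pre i V' `<=` mor_pre i V by move=> x /V'V.
  have kO : mor_pre i V' `<=` mor_pre i O by move=> x /V'O.
  have kD : mor_pre i V' `<=` unit_locus (mor_sh i O g').
    by move=> x [_ ux] /=; apply/unit_at_mor_sh => //; exact: (unit_at_in ux).
  exists V', V'V, k, (res V'O c' * u).
  split; first by split=> //; exact/(unit_at_mor_sh _ Oz).
  apply: (unit_at_cancel_local (f := res kO (mor_sh i O g'))).
    by move=> x V'x; apply/unit_at_res => //; exact: kD.
  rewrite (mor_res V'O) -rmorphM -mulrA [u * _]mulrC gu mulr1.
  rewrite -!(mor_res V'O kO) -(res_comp h kD k) -!(res_comp l kD kO).
  by rewrite -rmorphM e.
pose V' := openI_ V (Opens (closed_openC cl)).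
have V'V : V' `<=` V by move=> x [].
have k : mor_pre i V' `<=` mor_pre i V by move=> x /V'V.
(* The preimage of V' is empty, so that 0 is its only section. *)
exists V', V'V, k, 0; split=> //.
by apply: sect_eq_local => x [_]; case; exists x.
Qed.

End ClosedImmersion.

(** * The embedding of the tangent variety *)

Lemma mor_pull_comp (X Y Z : ringedSpace) (g : mor Y Z) (f : mor X Y)
    (V : opens Z) (W : opens Y) (U : opens X)
    (h : U `<=` mor_pre (mor_comp g f) V)
    (k : W `<=` mor_pre g V) (l : U `<=` mor_pre f W) s :
  mor_pull h s = mor_pull l (mor_pull k s).
Proof.
have h' : U `<=` mor_pre f (mor_pre g V) by move=> x /l/k.
rewrite [RHS](_ : _ = mor_pull h' (mor_sh g V s)); last exact: mor_pull_res.
by rewrite /mor_pull /= res_res; exact: eq_res.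
Qed.

Section Embedding.
Variables (K : comPzRingType) (delta : K -> K) (X : kscheme K).
Variables (TX : tangentVariety X) (CX : prolongationCone delta X).

(** Over each affine open U, the morphism i is the spectrum of the surjection
    from Sym of tau-differentials to Sym of Kaehler differentials. *)
Definition is_tangent_to_cone (i : mor TX CX) : Prop :=
  forall (U : opens X) (aU : affine U),
    exists h : mor_pre (rs_proj TX) U `<=` mor_pre i (mor_pre (rs_proj CX) U),
    forall a, mor_pull h (rs_iso CX aU a)
              = rs_iso TX aU (sym_tau_to_kahler delta (sectAlg U) a).

(** The morphism is glued over all affine open subsets of X. Naturality of the
    surjection with respect to restrictions makes the pieces compatible. *)
Lemma tangent_to_cone_ex : exists i : mor TX CX, is_tangent_to_cone i.
Proof.
pose J := {U : opens X | affine U}.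
pose O (j : J) := mor_pre (rs_proj CX) (sval j).
pose N (j : J) := mor_pre (rs_proj TX) (sval j).
have phi_ex (j : J) : exists f : {rmorphism sect CX (O j) -> sect TX (N j)},
    forall a, f (rs_iso CX (svalP j) a)
      = rs_iso TX (svalP j) (sym_tau_to_kahler delta (sectAlg (sval j)) a).
  exact: (@rmorph_factor _ _ _ (rs_iso CX (svalP j))
    (rs_iso TX (svalP j) \o sym_tau_to_kahler delta (sectAlg (sval j)))
    (rs_bij CX (svalP j))).
pose phi j := sval (cid (phi_ex j)).
have phiE j (aU : affine (sval j)) a : phi j (rs_iso CX aU a)
    = rs_iso TX aU (sym_tau_to_kahler delta (sectAlg (sval j)) a).
  rewrite (Prop_irrelevance aU (svalP j)).
  exact: (svalP (cid (phi_ex j))).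
have phi_res (j k : J) (h : sval k `<=` sval j) (hO : O k `<=` O j)
    (hN : N k `<=` N j) s : res hN (phi j s) = phi k (res hO s).
  have [iso' isoK isoK'] := rs_bij CX (svalP j).
  rewrite -(isoK' s) phiE (rs_res _ (svalP k) h) (rs_res _ (svalP k) h) phiE.
  by rewrite sym_tau_to_kahler_nat.
have [||j k z Njz Nkz|i iP] := @mor_glue TX CX J O N phi.
- by move=> j; apply: rs_affine; exact: svalP.
- move=> z; have [U [aU Uz]] := scheme_affine (rs_proj TX z).
  by exists (exist _ U aU).
- have [W [aW Wjk Wz]] := @affine_nbhs X (rs_proj TX z)
    (openI_ (sval j) (sval k)) (conj Njz Nkz).
  have Wj : W `<=` sval j by move=> x /Wjk[].
  have Wk : W `<=` sval k by move=> x /Wjk[].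
  pose l : J := exist _ W aW.
  have hj : O l `<=` O j by move=> x /Wj.
  have hk : O l `<=` O k by move=> x /Wk.
  have nj : N l `<=` N j by move=> x /Wj.
  have nk : N l `<=` N k by move=> x /Wk.
  exists l, hj, hk, nj, nk; split=> // s; exact: phi_res.
exists i => U aU; have [h hP] := iP (exist _ U aU).
by exists h => a; exact: etrans (hP _) (phiE (exist _ U aU) aU a).
Qed.

Variable i : mor TX CX.
Hypothesis iP : is_tangent_to_cone i.

(** The surjection is a homomorphism of algebras over the sections of X. *)
Lemma tangent_to_cone_over : mor_eq (mor_comp (rs_proj CX) i) (rs_proj TX).
Proof.
apply: mor_eq_local => z; have [U [aU Uz]] := scheme_affine (rs_proj TX z).
have [h hP] := iP aU.
exists U, (mor_pre (rs_proj TX) U), h, (@subset_refl _ _); split=> // s.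
rewrite (mor_pull_comp h (@subset_refl _ _) h) /mor_pull /= !res_id.
rewrite -(rs_str CX aU) -(rs_str TX aU) -(sym_tau_to_kahler_const delta) -hP.
by rewrite /mor_pull.
Qed.

Lemma tangent_to_cone_closed_immersion : closed_immersion i.
Proof.
apply: closed_immersion_affine => y.
have [U [aU Uy]] := scheme_affine (rs_proj CX y).
have [h hP] := iP aU.
have eN : mor_pre (rs_proj TX) U = mor_pre i (mor_pre (rs_proj CX) U).
  apply: opens_eq; apply/seteqP; split=> // z /=.
  by rewrite -(tangent_to_cone_over.1 z).
exists (mor_pre (rs_proj CX) U); split=> //.
- exact: rs_affine.
- by rewrite -eN; exact: rs_affine.
move=> b.
have [iso' isoK isoK'] := rs_bij TX aU.
have [a ab] := sym_tau_to_kahler_onto delta (iso' (res h b)).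
exists (rs_iso CX aU a); apply: sect_eq_local => z Nz.
exists (mor_pre (rs_proj TX) U), h; split; first by rewrite eN.
by move: (hP a); rewrite ab isoK'.
Qed.

End Embedding.

(** Both composites send a section over the preimage of an affine V in Y to its
    image under f and the surjection, applied in the two possible orders. *)
Lemma tangent_to_cone_nat (K : comPzRingType) (delta : K -> K)
    (X Y : kscheme K) (f : kmor X Y)
    (TX : tangentVariety X) (TY : tangentVariety Y)
    (CX : prolongationCone delta X) (CY : prolongationCone delta Y)
    (iX : mor TX CX) (iY : mor TY CY) (Tf : mor TX TY) (Cf : mor CX CY) :
  is_tangent_to_cone iX -> is_tangent_to_cone iY ->
  rs_induced f Tf -> rs_induced f Cf ->
  mor_eq (mor_comp iY Tf) (mor_comp Cf iX).
Proof.
move=> iXP iYP [Tfo TfE] [Cfo CfE].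
apply: mor_eq_local => z.
have [V [aV Vz]] := scheme_affine (f (rs_proj TX z)).
have [U [aU UV Uz]] := @affine_nbhs X (rs_proj TX z) (mor_pre f V) Vz.
have [hX hXP] := iXP U aU; have [hY hYP] := iYP V aV.
have kT : mor_pre (rs_proj TX) U `<=` mor_pre Tf (mor_pre (rs_proj TY) V).
  by move=> x Ux; rewrite /= (Tfo.1 x : rs_proj TY (Tf x) = _); exact: UV.
have kC : mor_pre (rs_proj CX) U `<=` mor_pre Cf (mor_pre (rs_proj CY) V).
  by move=> x Ux; rewrite /= (Cfo.1 x : rs_proj CY (Cf x) = _); exact: UV.
have hTY : mor_pre (rs_proj TX) U `<=`
    mor_pre (mor_comp iY Tf) (mor_pre (rs_proj CY) V).
  by move=> x /kT/hY.
have hCX : mor_pre (rs_proj TX) U `<=`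
    mor_pre (mor_comp Cf iX) (mor_pre (rs_proj CY) V).
  by move=> x /hX/kC.
exists (mor_pre (rs_proj CY) V), (mor_pre (rs_proj TX) U), hTY, hCX.
split=> // [|s]; first exact: rs_affine.
have [iso' _ isoK] := rs_bij CY aV; rewrite -(isoK s).
rewrite (mor_pull_comp hTY hY kT) (mor_pull_comp hCX kC hX).
by rewrite hYP (TfE _ _ aU aV UV) (CfE _ _ aU aV UV) hXP sym_tau_to_kahler_nat.
Qed.

Theorem corollary4p5 (K : closedFieldType) (delta : K -> K)
    (Hdelta : derivation delta) (e : K) (He : delta e = 1) :
  exists i : forall (X : variety K) (TX : tangentVariety X)
                    (CX : prolongationCone delta X), mor TX CX,
    (forall (X : variety K) (TX : tangentVariety X)
            (CX : prolongationCone delta X),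
        closed_immersion (i X TX CX) /\
        mor_eq (mor_comp (rs_proj CX) (i X TX CX)) (rs_proj TX)) /\
    (forall (X Y : variety K) (f : kmor X Y)
            (TX : tangentVariety X) (TY : tangentVariety Y)
            (CX : prolongationCone delta X) (CY : prolongationCone delta Y)
            (Tf : mor TX TY) (Cf : mor CX CY),
        rs_induced f Tf -> rs_induced f Cf ->
        mor_eq (mor_comp (i Y TY CY) Tf) (mor_comp Cf (i X TX CX))).
Proof.
pose i (X : variety K) (TX : tangentVariety X) (CX : prolongationCone delta X) :=
  cid (tangent_to_cone_ex TX CX).
exists (fun X TX CX => sval (i X TX CX)).
split=> [X TX CX | X Y f TX TY CX CY Tf Cf Tf_ind Cf_ind].
  have iP := svalP (i X TX CX).
  split; first exact: tangent_to_cone_closed_immersion.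
  exact: tangent_to_cone_over.
by apply: tangent_to_cone_nat Tf_ind Cf_ind; exact: svalP.
Qed.
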